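(* The translation $(-)^\ast$ defined in the context is a compatible translation of $\mathbf{HA}^\omega + \mathbf{iRC!}_{\mathbf{N},\mathbf{N}}$ in Aczel's constructive set theory $\mathbf{CZF}$. That is, whenever a formula $\phi$ with free variables among $x_1^{\sigma_1},\dots,x_n^{\sigma_n}$ is derivable in $\mathbf{HA}^\omega + \mathbf{iRC!}_{\mathbf{N},\mathbf{N}}$, $\mathbf{CZF}$ proves $x_1\in\sigma_1^\ast\land\dots\land x_n\in\sigma_n^\ast\to\phi^\ast$.
   Context: Finite types: $\mathbf{N}$ is a finite type, and if $\sigma,\tau$ are finite types then so are $\sigma\to\tau$ and $\sigma\times\tau$. $\mathbf{HA}^\omega$ (Heyting arithmetic in all finite types) is the many-sorted intuitionistic first-order theory with countably many variables $x^\sigma,y^\sigma,\dots$ for each finite type $\sigma$, an equality predicate $=_\sigma$ for each type, application operators, and constants for zero, successor, recursors, pairing, projections, and the combinators $\mathbf{k}$ and $\mathbf{s}$. Its axioms are those of many-sorted intuitionistic predicate logic with equality, congruence rules for equality, the usual axioms for zero and successor, the induction scheme for all formulas, and the defining equations of the constants. $\exists! y^\tau\,\phi(x,y)$ abbreviates $\exists y^\tau\phi(x,y)\land\forall y_1^\tau\forall y_2^\tau(\phi(x,y_1)\land\phi(x,y_2)\supset y_1=_\tau y_2)$, where $\supset$ is implication. $\mathbf{iRC!}_{\mathbf{N},\mathbf{N}}$ is the rule: if $\forall x^{\mathbf{N}}\exists! y^{\mathbf{N}}\,\phi(x,y)$ is derivable, then $\exists f^{\mathbf{N}\to\mathbf{N}}\forall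 x^{\mathbf{N}}\,\phi(x,fx)$ is derivable; in the extended theory it applies to everything derivable in that theory. $\mathbf{CZF}$ is the theory in the language of set theory, over intuitionistic logic, with axioms extensionality, pairing, union, separation restricted to $\Delta_0$-formulas, infinity, $\in$-induction, strong collection and subset collection. A translation of one theory into another is called compatible if it preserves the meaning of logical and set-theoretical constructors, so that a proof of a theorem of the first theory is transported to a proof of its translation. The translation $(-)^\ast$: $\mathbf{N}^\ast:\equiv\omega$; $(\sigma\to\tau)^\ast:\equiv\sigma^\ast\to\tau^\ast$, the set of functional relations from $\sigma^\ast$ to $\tau^\ast$; $(\sigma\times\tau)^\ast:\equiv\sigma^\ast\times\tau^\ast$, the cartesian product of sets. Terms are interpreted by the corresponding definable terms of $\mathbf{CZF}$. Formulas are interpreted by the corresponding formulas of intuitionistic logic with sorts read as predicates: equality goes to equality, connectives to the same connectives, $(\forall x^\sigma\phi)^\ast:\equiv\forall x(x\in\sigma^\ast\to\phi^\ast(x))$ and $(\exists x^\sigma\phi)^\ast:\equiv\exists x(x\in\sigma^\ast\land\phi^\ast(x))$. *)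

(* Defs.v *)
From Stdlib Require Import List.
Import ListNotations.

Set Implicit Arguments.
Unset Strict Implicit.
Unset Printing Implicit Defensive.

(** * Heyting arithmetic in all finite types *)

Inductive ty : Type :=
| N : ty
| Arr : ty -> ty -> ty
| Prod : ty -> ty -> ty.

Declare Scope ty_scope.
Delimit Scope ty_scope with ty.
Bind Scope ty_scope with ty.
Notation "s ⇒ t" := (Arr s t) (at level 55, right associativity) : ty_scope.
Notation "s ⊗ t" := (Prod s t) (at level 50, left associativity) : ty_scope.
Open Scope ty_scope.

(** The syntax is well typed by construction: a context [G] lists the sorts of
    the available variables, in de Bruijn order (the head is the variable bound
    last).  A formula with free variables among x_1^s_1, ..., x_n^s_n is an
    element of [fm [s_1; ...; s_n]]. *)
Inductive var : list ty -> ty -> Type :=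
| VZ : forall G s, var (s :: G) s
| VS : forall G s t, var G t -> var (s :: G) t.

Inductive cst : ty -> Type :=
| Zero : cst N
| Succ : cst (N ⇒ N)
| Rec : forall s, cst (s ⇒ (s ⇒ N ⇒ s) ⇒ N ⇒ s)
| Pair : forall s t, cst (s ⇒ t ⇒ s ⊗ t)
| Fst : forall s t, cst (s ⊗ t ⇒ s)
| Snd : forall s t, cst (s ⊗ t ⇒ t)
| CombK : forall s t, cst (s ⇒ t ⇒ s)
| CombS : forall r s t, cst ((r ⇒ s ⇒ t) ⇒ (r ⇒ s) ⇒ r ⇒ t).

Inductive tm (G : list ty) : ty -> Type :=
| TVar : forall s, var G s -> tm G s
| TCst : forall s, cst s -> tm G s
| TApp : forall s t, tm G (s ⇒ t) -> tm G s -> tm G t.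

Inductive fm : list ty -> Type :=
| FBot : forall G, fm G
| FEq : forall G s, tm G s -> tm G s -> fm G
| FAnd : forall G, fm G -> fm G -> fm G
| FOr : forall G, fm G -> fm G -> fm G
| FImp : forall G, fm G -> fm G -> fm G
| FAll : forall G s, fm (s :: G) -> fm G
| FEx : forall G s, fm (s :: G) -> fm G.

Arguments VZ {G s}.
Arguments VS {G s t} _.
Arguments TCst {G s} _.
Arguments FBot {G}.

(** Capture-avoiding parallel substitution. *)

Definition sub (G D : list ty) : Type := forall s, var G s -> tm D s.

Fixpoint tren (G D : list ty) (r : forall s, var G s -> var D s) (s : ty)
    (a : tm G s) : tm D s :=
  match a with
  | TVar v => TVar (r _ v)
  | TCst c => TCst c
  | TApp f b => TApp (tren r f) (tren r b)
  end.

Definition shift (G : list ty) (t : ty) : sub G (t :: G) :=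
  fun s v => TVar (VS v).
Arguments shift {G t} s _.

Definition scons (G D : list ty) (t : ty) (a : tm D t) (e : sub G D) :
    sub (t :: G) D :=
  fun s v =>
    match v in var G' s'
      return match G' with
             | [] => unit
             | t' :: G0 => tm D t' -> sub G0 D -> tm D s'
             end
    with
    | VZ => fun a _ => a
    | VS v' => fun _ e => e _ v'
    end a e.

Definition up (G D : list ty) (t : ty) (e : sub G D) : sub (t :: G) (t :: D) :=
  scons (TVar VZ) (fun s v => tren (fun _ => VS) (e s v)).
Arguments up {G D t} e s _.

Fixpoint tsub (G D : list ty) (e : sub G D) (s : ty) (a : tm G s) : tm D s :=
  match a with
  | TVar v => e _ v
  | TCst c => TCst c
  | TApp f b => TApp (tsub e f) (tsub e b)
  end.

Fixpoint fsub (G D : list ty) (e : sub G D) (A : fm G) : fm D :=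
  match A in fm G' return sub G' D -> fm D with
  | FBot => fun _ => FBot
  | FEq a b => fun e => FEq (tsub e a) (tsub e b)
  | FAnd A B => fun e => FAnd (fsub e A) (fsub e B)
  | FOr A B => fun e => FOr (fsub e A) (fsub e B)
  | FImp A B => fun e => FImp (fsub e A) (fsub e B)
  | FAll A => fun e => FAll (fsub (up e) A)
  | FEx A => fun e => FEx (fsub (up e) A)
  end e.

Definition fwk (G : list ty) (t : ty) (A : fm G) : fm (t :: G) :=
  fsub shift A.
Arguments fwk {G} t A.

Definition finst (G : list ty) (t : ty) (A : fm (t :: G)) (a : tm G t) : fm G :=
  fsub (scons a (@TVar G)) A.

Definition v0 {G s} : tm (s :: G) s := TVar VZ.
Definition v1 {G s s'} : tm (s' :: s :: G) s := TVar (VS VZ).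
Definition shift2 {G s s'} : sub G (s' :: s :: G) := fun _ v => TVar (VS (VS v)).

Definition tsucc {G} (a : tm G N) : tm G N := TApp (TCst Succ) a.

(** ∃!y A(y), i.e. ∃y A(y) ∧ ∀y1 ∀y2 (A(y1) ∧ A(y2) ⊃ y1 = y2). *)
Definition FExU (G : list ty) (t : ty) (A : fm (t :: G)) : fm G :=
  FAnd (FEx A)
       (FAll (FAll (FImp (FAnd (fsub (scons v1 shift2) A)
                               (fsub (scons v0 shift2) A))
                         (FEq v1 v0)))).

Inductive HAax (G : list ty) : fm G -> Prop :=
| ax_refl : forall s (a : tm G s), HAax (FEq a a)
| ax_sym : forall s (a b : tm G s), HAax (FImp (FEq a b) (FEq b a))
| ax_trans : forall s (a b c : tm G s),
    HAax (FImp (FEq a b) (FImp (FEq b c) (FEq a c)))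
| ax_cong : forall s t (f g : tm G (s ⇒ t)) (a b : tm G s),
    HAax (FImp (FEq f g) (FImp (FEq a b) (FEq (TApp f a) (TApp g b))))
| ax_succ_neq0 : forall a : tm G N,
    HAax (FImp (FEq (tsucc a) (TCst Zero)) FBot)
| ax_succ_inj : forall a b : tm G N,
    HAax (FImp (FEq (tsucc a) (tsucc b)) (FEq a b))
| ax_ind : forall A : fm (N :: G),
    HAax (FImp (FAnd (finst A (TCst Zero))
                     (FAll (FImp A (fsub (scons (tsucc v0) shift) A))))
               (FAll A))
| ax_rec0 : forall s (a : tm G s) (f : tm G (s ⇒ N ⇒ s)),
    HAax (FEq (TApp (TApp (TApp (TCst (Rec s)) a) f) (TCst Zero)) a)
| ax_recS : forall s (a : tm G s) (f : tm G (s ⇒ N ⇒ s)) (n : tm G N),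
    HAax (FEq (TApp (TApp (TApp (TCst (Rec s)) a) f) (tsucc n))
              (TApp (TApp f (TApp (TApp (TApp (TCst (Rec s)) a) f) n)) n))
| ax_fst : forall s t (a : tm G s) (b : tm G t),
    HAax (FEq (TApp (TCst (Fst s t)) (TApp (TApp (TCst (Pair s t)) a) b)) a)
| ax_snd : forall s t (a : tm G s) (b : tm G t),
    HAax (FEq (TApp (TCst (Snd s t)) (TApp (TApp (TCst (Pair s t)) a) b)) b)
| ax_pair : forall s t (p : tm G (s ⊗ t)),
    HAax (FEq (TApp (TApp (TCst (Pair s t)) (TApp (TCst (Fst s t)) p))
                    (TApp (TCst (Snd s t)) p)) p)
| ax_K : forall s t (a : tm G s) (b : tm G t),
    HAax (FEq (TApp (TApp (TCst (CombK s t)) a) b) a)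
| ax_S : forall r s t (f : tm G (r ⇒ s ⇒ t)) (g : tm G (r ⇒ s)) (a : tm G r),
    HAax (FEq (TApp (TApp (TApp (TCst (CombS r s t)) f) g) a)
              (TApp (TApp f a) (TApp g a))).

(** Natural deduction for HA^omega + iRC!_{N,N}.  The premise of the rule
    [ha_iRC] has no open assumption: the rule applies to theorems only (which
    may have further free variables, those of [G]). *)
Inductive HA : forall G : list ty, list (fm G) -> fm G -> Prop :=
| ha_hyp : forall G (H : list (fm G)) A, In A H -> HA H A
| ha_ax : forall G (H : list (fm G)) A, HAax A -> HA H A
| ha_botE : forall G (H : list (fm G)) A, HA H FBot -> HA H A
| ha_andI : forall G (H : list (fm G)) A B, HA H A -> HA H B -> HA H (FAnd A B)
| ha_andE1 : forall G (H : list (fm G)) A B, HA H (FAnd A B) -> HA H A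
| ha_andE2 : forall G (H : list (fm G)) A B, HA H (FAnd A B) -> HA H B
| ha_orI1 : forall G (H : list (fm G)) A B, HA H A -> HA H (FOr A B)
| ha_orI2 : forall G (H : list (fm G)) A B, HA H B -> HA H (FOr A B)
| ha_orE : forall G (H : list (fm G)) A B C,
    HA H (FOr A B) -> HA (A :: H) C -> HA (B :: H) C -> HA H C
| ha_impI : forall G (H : list (fm G)) A B, HA (A :: H) B -> HA H (FImp A B)
| ha_impE : forall G (H : list (fm G)) A B, HA H (FImp A B) -> HA H A -> HA H B
| ha_allI : forall G (H : list (fm G)) s (A : fm (s :: G)),
    HA (map (fwk s) H) A -> HA H (FAll A)
| ha_allE : forall G (H : list (fm G)) s (A : fm (s :: G)) (a : tm G s),
    HA H (FAll A) -> HA H (finst A a)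
| ha_exI : forall G (H : list (fm G)) s (A : fm (s :: G)) (a : tm G s),
    HA H (finst A a) -> HA H (FEx A)
| ha_exE : forall G (H : list (fm G)) s (A : fm (s :: G)) (C : fm G),
    HA H (FEx A) -> HA (A :: map (fwk s) H) (fwk s C) -> HA H C
| ha_iRC : forall G (H : list (fm G)) (A : fm (N :: N :: G)),
    HA [] (FAll (FExU A)) ->
    HA H (FEx (s := N ⇒ N)
              (FAll (s := N) (fsub (scons (TApp v1 v0) (scons v0 shift2)) A))).

Definition HAderivable (G : list ty) (A : fm G) : Prop := HA [] A.

(** A derivation in context [G] uses only the variables of [G].  This is no
    restriction on derivability, since every sort has a closed term: *)

Fixpoint closed_tm (G : list ty) (s : ty) : tm G s :=
  match s with
  | N => TCst Zero
  | s1 ⇒ s2 => TApp (TCst (CombK s2 s1)) (closed_tm G s2)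
  | s1 ⊗ s2 => TApp (TApp (TCst (Pair s1 s2)) (closed_tm G s1)) (closed_tm G s2)
  end.

Lemma HA_incl (G : list ty) (H H' : list (fm G)) (A : fm G) :
  HA H A -> incl H H' -> HA H' A.
Proof.
intro d; revert H'; induction d; intros H' i.
- now apply ha_hyp, i.
- now apply ha_ax.
- now apply ha_botE; auto.
- now apply ha_andI; auto.
- now apply ha_andE1 with B; auto.
- now apply ha_andE2 with A; auto.
- now apply ha_orI1; auto.
- now apply ha_orI2; auto.
- apply ha_orE with A B; [ auto | apply IHd2 | apply IHd3 ];
    apply incl_cons; [ now left | now apply incl_tl | now left | now apply incl_tl ].
- apply ha_impI, IHd, incl_cons; [ now left | now apply incl_tl ].
- now apply ha_impE with A; auto.
- now apply ha_allI, IHd, incl_map.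
- now apply ha_allE; auto.
- now apply ha_exI with a; auto.
- apply ha_exE with s A; [ auto | apply IHd2, incl_cons ];
    [ now left | now apply incl_tl, incl_map ].
- now apply ha_iRC.
Qed.

Lemma HA_drop_var (G : list ty) (s : ty) (A : fm G) :
  HAderivable (fwk s A) -> HAderivable A.
Proof.
intro d; apply ha_exE with s (FEq v0 v0).
- now apply ha_exI with (closed_tm G s), ha_ax, ax_refl.
- now apply HA_incl with (1 := d).
Qed.

(** * Constructive Zermelo-Fraenkel set theory *)

(** Variables, the only terms of the language, are de Bruijn indices. *)
Inductive sfm : Type :=
| Bot : sfm
| Mem : nat -> nat -> sfm
| Eqs : nat -> nat -> sfm
| And : sfm -> sfm -> sfm
| Or : sfm -> sfm -> sfm
| Imp : sfm -> sfm -> sfm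
| All : sfm -> sfm
| Ex : sfm -> sfm.

Declare Scope sfm_scope.
Delimit Scope sfm_scope with sfm.
Bind Scope sfm_scope with sfm.
Notation "x ∈ y" := (Mem x y) (at level 70) : sfm_scope.
Notation "x ≐ y" := (Eqs x y) (at level 70) : sfm_scope.
Notation "A ∧ B" := (And A B) (at level 80, right associativity) : sfm_scope.
Notation "A ∨ B" := (Or A B) (at level 85, right associativity) : sfm_scope.
Notation "A ⊃ B" := (Imp A B) (at level 90, right associativity) : sfm_scope.
Notation "A ≡ B" := (And (Imp A B) (Imp B A)) (at level 95) : sfm_scope.
Open Scope sfm_scope.

Definition BAll (a : nat) (A : sfm) : sfm := All (0 ∈ S a ⊃ A).
Definition BEx (a : nat) (A : sfm) : sfm := Ex (0 ∈ S a ∧ A).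

Definition ncons (x : nat) (r : nat -> nat) : nat -> nat :=
  fun i => match i with 0 => x | S j => r j end.

Definition upr (r : nat -> nat) : nat -> nat := ncons 0 (fun i => S (r i)).

Fixpoint sren (r : nat -> nat) (A : sfm) : sfm :=
  match A with
  | Bot => Bot
  | x ∈ y => r x ∈ r y
  | x ≐ y => r x ≐ r y
  | A ∧ B => sren r A ∧ sren r B
  | A ∨ B => sren r A ∨ sren r B
  | A ⊃ B => sren r A ⊃ sren r B
  | All A => All (sren (upr r) A)
  | Ex A => Ex (sren (upr r) A)
  end.

Definition sinst (A : sfm) (x : nat) : sfm := sren (ncons x (fun i => i)) A.

Inductive Delta0 : sfm -> Prop :=
| D0_bot : Delta0 Bot
| D0_mem : forall x y, Delta0 (x ∈ y)
| D0_eq : forall x y, Delta0 (x ≐ y)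
| D0_and : forall A B, Delta0 A -> Delta0 B -> Delta0 (A ∧ B)
| D0_or : forall A B, Delta0 A -> Delta0 B -> Delta0 (A ∨ B)
| D0_imp : forall A B, Delta0 A -> Delta0 B -> Delta0 (A ⊃ B)
| D0_all : forall a A, Delta0 A -> Delta0 (BAll a A)
| D0_ex : forall a A, Delta0 A -> Delta0 (BEx a A).

(** In the following, [z], [x], ... are variables of the ambient scope; [isT z
    x y] reads "z = T(x, y)". *)

Definition isEmpty (z : nat) : sfm := BAll z Bot.

(** z = x ∪ {x} *)
Definition isSucc (z x : nat) : sfm := All (0 ∈ S z ≡ 0 ∈ S x ∨ 0 ≐ S x).

(** z = {x, y} *)
Definition isUpair (z x y : nat) : sfm := All (0 ∈ S z ≡ 0 ≐ S x ∨ 0 ≐ S y).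

(** z = {{x}, {x, y}} *)
Definition isPair (z x y : nat) : sfm :=
  All (0 ∈ S z ≡ isUpair 0 (S x) (S x) ∨ isUpair 0 (S x) (S y)).

(** (x, y) ∈ f *)
Definition pairIn (x y f : nat) : sfm := BEx f (isPair 0 (S x) (S y)).

(** ∀u (u ∈ z ↔ u = ∅ ∨ ∃v ∈ z (u = v ∪ {v})); by ∈-induction there is at most
    one such z. *)
Definition isOmega (z : nat) : sfm :=
  All (0 ∈ S z ≡ isEmpty 0 ∨ BEx (S z) (isSucc 1 0)).

Definition isProd (z a b : nat) : sfm :=
  All (0 ∈ S z ≡ BEx (S a) (BEx (2 + b) (isPair 2 1 0))).

(** f ⊆ a × b ∧ ∀x ∈ a ∃!y ∈ b ((x, y) ∈ f) *)
Definition isFunction (f a b : nat) : sfm :=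
  BAll f (BEx (S a) (BEx (2 + b) (isPair 2 1 0))) ∧
  BAll a (BEx (S b) (pairIn 1 0 (2 + f)) ∧
          All (All (pairIn 2 1 (3 + f) ∧ pairIn 2 0 (3 + f) ⊃ 1 ≐ 0))).

Definition isFunSet (z a b : nat) : sfm :=
  All (0 ∈ S z ≡ isFunction 0 (S a) (S b)).

(** Schematic formulas may contain parameters.  [upr S] (resp. [upr (upr S)])
    renames a formula whose first (resp. first two) variables are the displayed
    ones, in order to skip a set quantified just outside them. *)
Inductive CZFax : sfm -> Prop :=
| czf_ext : CZFax (All (All (All (0 ∈ 2 ≡ 0 ∈ 1) ⊃ 1 ≐ 0)))
| czf_pairing : CZFax (All (All (Ex (All (0 ∈ 1 ≡ 0 ≐ 3 ∨ 0 ≐ 2)))))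
| czf_union : CZFax (All (Ex (All (0 ∈ 1 ≡ BEx 2 (1 ∈ 0)))))
| czf_sep : forall A, Delta0 A ->
    CZFax (All (Ex (All (0 ∈ 1 ≡ 0 ∈ 2 ∧ sren (upr S) A))))
| czf_infinity : CZFax (Ex (isOmega 0))
| czf_ind : forall A,
    CZFax (All (BAll 0 (sren (upr S) A) ⊃ A) ⊃ All A)
(** ∀a (∀x∈a ∃y A(y,x,a) ⊃
        ∃b (∀x∈a ∃y∈b A(y,x,a) ∧ ∀y∈b ∃x∈a A(y,x,a))) *)
| czf_strong_coll : forall A,
    CZFax (All (BAll 0 (Ex A) ⊃
      Ex (BAll 1 (BEx 1 (sren (upr (upr S)) A)) ∧
          BAll 0 (BEx 2 (sren (ncons 1 (ncons 0 (fun i => 3 + i))) A)))))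
(** ∀a ∀b ∃c ∀u (∀x∈a ∃y∈b A(y,x,u,b,a) ⊃
        ∃d∈c (∀x∈a ∃y∈d A(y,x,u,b,a) ∧ ∀y∈d ∃x∈a A(y,x,u,b,a))) *)
| czf_subset_coll : forall A,
    CZFax (All (All (Ex (All (
      BAll 3 (BEx 3 (sren (ncons 0 (ncons 1 (ncons 2 (fun i => 4 + i)))) A)) ⊃
      BEx 1
       (BAll 4 (BEx 1 (sren (ncons 0 (ncons 1 (ncons 3 (fun i => 5 + i)))) A)) ∧
        BAll 0 (BEx 5 (sren (ncons 1 (ncons 0 (ncons 3 (fun i => 5 + i)))) A)))))))).

Inductive CZF : list sfm -> sfm -> Prop :=
| cz_hyp : forall H A, In A H -> CZF H A
| cz_ax : forall H A, CZFax A -> CZF H A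
| cz_refl : forall H x, CZF H (x ≐ x)
| cz_leibniz : forall H A x y, CZF H (x ≐ y) -> CZF H (sinst A x) -> CZF H (sinst A y)
| cz_botE : forall H A, CZF H Bot -> CZF H A
| cz_andI : forall H A B, CZF H A -> CZF H B -> CZF H (A ∧ B)
| cz_andE1 : forall H A B, CZF H (A ∧ B) -> CZF H A
| cz_andE2 : forall H A B, CZF H (A ∧ B) -> CZF H B
| cz_orI1 : forall H A B, CZF H A -> CZF H (A ∨ B)
| cz_orI2 : forall H A B, CZF H B -> CZF H (A ∨ B)
| cz_orE : forall H A B C,
    CZF H (A ∨ B) -> CZF (A :: H) C -> CZF (B :: H) C -> CZF H C
| cz_impI : forall H A B, CZF (A :: H) B -> CZF H (A ⊃ B)
| cz_impE : forall H A B, CZF H (A ⊃ B) -> CZF H A -> CZF H B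
| cz_allI : forall H A, CZF (map (sren S) H) A -> CZF H (All A)
| cz_allE : forall H A x, CZF H (All A) -> CZF H (sinst A x)
| cz_exI : forall H A x, CZF H (sinst A x) -> CZF H (Ex A)
| cz_exE : forall H A C,
    CZF H (Ex A) -> CZF (A :: map (sren S) H) (sren S C) -> CZF H C.

Definition CZFproves (A : sfm) : Prop := CZF [] A.

(** * The translation *)

(** Definable terms of CZF.  [DLam a b] is the function with domain [a] and
    value [b] (in which index 0 is bound) at its argument; [DRec a b f] is the
    function h : ω → a with h(0) = b and h(n + 1) = f(h(n))(n). *)
Inductive dtm : Type :=
| DVar : nat -> dtm
| DEmpty : dtm
| DOmega : dtm
| DSucc : dtm -> dtm
| DPair : dtm -> dtm -> dtm
| DFst : dtm -> dtm
| DSnd : dtm -> dtm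
| DProd : dtm -> dtm -> dtm
| DFunSet : dtm -> dtm -> dtm
| DApp : dtm -> dtm -> dtm
| DLam : dtm -> dtm -> dtm
| DRec : dtm -> dtm -> dtm -> dtm.

(** As the language of CZF has no function symbols, a definable term [t] stands
    for its defining formula: [den r t z] is "z = t", where [r i] is the
    variable that index [i] of [t] denotes in the current scope. *)
Fixpoint den (r : nat -> nat) (t : dtm) (z : nat) : sfm :=
  let r1 i := 1 + r i in
  let r2 i := 2 + r i in
  match t with
  | DVar i => z ≐ r i
  | DEmpty => isEmpty z
  | DOmega => isOmega z
  | DSucc t => Ex (den r1 t 0 ∧ isSucc (1 + z) 0)
  | DPair t u => Ex (Ex (den r2 t 1 ∧ den r2 u 0 ∧ isPair (2 + z) 1 0))
  | DFst t => Ex (Ex (den r2 t 1 ∧ isPair 1 (2 + z) 0))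
  | DSnd t => Ex (Ex (den r2 t 1 ∧ isPair 1 0 (2 + z)))
  | DProd a b => Ex (Ex (den r2 a 1 ∧ den r2 b 0 ∧ isProd (2 + z) 1 0))
  | DFunSet a b => Ex (Ex (den r2 a 1 ∧ den r2 b 0 ∧ isFunSet (2 + z) 1 0))
  | DApp f t => Ex (Ex (den r2 f 1 ∧ den r2 t 0 ∧ pairIn 0 (2 + z) 1))
  | DLam a b =>
      (* ∃a' (a' = a ∧ ∀p (p ∈ z ↔ ∃x ∈ a' ∃y (y = b(x) ∧ p = (x, y)))) *)
      Ex (den r1 a 0 ∧
          All (0 ∈ 2 + z ≡
               BEx 1 (Ex (den (ncons 1 (fun i => 4 + r i)) b 0 ∧ isPair 2 1 0))))
  | DRec a b f =>
      (* ∃w ∃a' ∃b' ∃f' (w = ω ∧ a' = a ∧ b' = b ∧ f' = f ∧ z : w → a' ∧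
           ∀u (u = ∅ ⊃ (u, b') ∈ z) ∧
           ∀n ∈ w ∀m ∀x ∀g ∀y (m = n ∪ {n} ∧ (n, x) ∈ z ∧
             (x, g) ∈ f' ∧ (n, y) ∈ g ⊃ (m, y) ∈ z)) *)
      let r4 i := 4 + r i in
      Ex (Ex (Ex (Ex (
        isOmega 3 ∧ den r4 a 2 ∧ den r4 b 1 ∧ den r4 f 0 ∧
        isFunction (4 + z) 3 2 ∧
        All (isEmpty 0 ⊃ pairIn 0 2 (5 + z)) ∧
        BAll 3 (All (All (All (All (
          isSucc 3 4 ∧ pairIn 4 2 (9 + z) ∧ pairIn 2 1 5 ∧ pairIn 4 0 1 ⊃
          pairIn 3 0 (9 + z))))))))))
  end.

Fixpoint ty_tr (s : ty) : dtm :=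
  match s with
  | N => DOmega
  | s ⇒ t => DFunSet (ty_tr s) (ty_tr t)
  | s ⊗ t => DProd (ty_tr s) (ty_tr t)
  end.

Definition cst_tr (s : ty) (c : cst s) : dtm :=
  match c with
  | Zero => DEmpty
  | Succ => DLam DOmega (DSucc (DVar 0))
  | Rec s =>
      DLam (ty_tr s) (DLam (ty_tr (s ⇒ N ⇒ s))
        (DRec (ty_tr s) (DVar 1) (DVar 0)))
  | Pair s t => DLam (ty_tr s) (DLam (ty_tr t) (DPair (DVar 1) (DVar 0)))
  | Fst s t => DLam (ty_tr (s ⊗ t)) (DFst (DVar 0))
  | Snd s t => DLam (ty_tr (s ⊗ t)) (DSnd (DVar 0))
  | CombK s t => DLam (ty_tr s) (DLam (ty_tr t) (DVar 1))
  | CombS r s t =>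
      DLam (ty_tr (r ⇒ s ⇒ t)) (DLam (ty_tr (r ⇒ s)) (DLam (ty_tr r)
        (DApp (DApp (DVar 2) (DVar 0)) (DApp (DVar 1) (DVar 0)))))
  end.

Fixpoint idx (G : list ty) (s : ty) (v : var G s) : nat :=
  match v with
  | VZ => 0
  | VS v => S (idx v)
  end.

Fixpoint tm_tr (G : list ty) (s : ty) (a : tm G s) : dtm :=
  match a with
  | TVar v => DVar (idx v)
  | TCst c => cst_tr c
  | TApp f b => DApp (tm_tr f) (tm_tr b)
  end.

(** t = u, for definable terms t and u *)
Definition eq_dtm (t u : dtm) : sfm :=
  Ex (Ex (den (Nat.add 2) t 1 ∧ den (Nat.add 2) u 0 ∧ 1 ≐ 0)).

(** x ∈ t, for a definable term t *)
Definition in_dtm (x : nat) (t : dtm) : sfm := Ex (den S t 0 ∧ S x ∈ 0).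

Fixpoint fm_tr (G : list ty) (A : fm G) : sfm :=
  match A with
  | FBot => Bot
  | FEq a b => eq_dtm (tm_tr a) (tm_tr b)
  | FAnd A B => fm_tr A ∧ fm_tr B
  | FOr A B => fm_tr A ∨ fm_tr B
  | FImp A B => fm_tr A ⊃ fm_tr B
  | @FAll _ s A => All (in_dtm 0 (ty_tr s) ⊃ fm_tr A)
  | @FEx _ s A => Ex (in_dtm 0 (ty_tr s) ∧ fm_tr A)
  end.

(** x_k ∈ s_1* ∧ x_(k+1) ∈ s_2* ∧ ... for [G = [s_1; s_2; ...]] *)
Fixpoint ctx_tr (k : nat) (G : list ty) : sfm :=
  match G with
  | [] => Bot ⊃ Bot
  | s :: G => in_dtm k (ty_tr s) ∧ ctx_tr (S k) G
  end.

(* Main.v *)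
(** Reasoning inside CZF is done with names: quantifier rules whose premises
    range over all variables are admissible, since some variable is fresh, and
    then object-level hypotheses can be kept as Coq hypotheses [Γ ⊢ A] that are
    weakened whenever Γ grows.

    Every definable term attached to a term of HA^ω denotes exactly one set, and
    this set belongs to the interpretation of its type.  The λ-abstractions exist
    as sets by strong collection, function sets by subset collection and
    separation, and recursors because the recursion equations single out a
    functional relation on ω: h(n) = x iff (n, x) lies in some set of pairs each
    justified, by the equations, from the others.  Soundness of the translation
    is then an induction on derivations, and the rule iRC! is sound because strong
    collection turns a provably functional relation on ω into its graph. *)

Require Import Defs.
From Stdlib Require Import List Arith Lia.
Import ListNotations.

Set Implicit Arguments.
Unset Strict Implicit.
Unset Printing Implicit Defensive.

(** The language of CZF has no terms, so substituting a term of HA^ω has no counterpart as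
    substitution in set theory. A translated formula is therefore read under a valuation:
    [sren r (fm_tr A)] states A of the sets named by [r]. Substitution then becomes a comparison of
    two valuations, the second assigning to each variable the value of the term put in its place.
    This comparison needs existence and uniqueness of values, hence variables ranging over the right
    sets, which is the invariant [env]. The second obstacle is that separation covers only
    Δ0-formulas, while the bodies of λ-abstractions and the formulas of iRC! contain unbounded
    quantifiers. Graphs are thus not cut out of a product. Strong collection is two-sided: each
    element of the collecting set is related to some argument, so for a functional relation the set
    of collected pairs is the graph itself. Separation serves only for the empty set and for picking
    out functions. Since ∈-induction is unrestricted, induction on ω holds for every formula, as
    HA^ω requires. *)

Notation "H ⊢ A" := (CZF H A%sfm) (at level 91, no associativity).

(** * Renaming *)

Lemma upr_ext r r' :
  (forall i, r i = r' i) -> forall i, upr r i = upr r' i.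
Proof. intros E [|i]; cbn; congruence. Qed.

Lemma sren_ext A : forall r r', (forall i, r i = r' i) -> sren r A = sren r' A.
Proof. induction A; intros r r' E; cbn; f_equal; auto using upr_ext. Qed.

Lemma sren_comp A : forall r r', sren r (sren r' A) = sren (fun i => r (r' i)) A.
Proof.
induction A; intros r r'; cbn; f_equal; auto;
  rewrite IHA; apply sren_ext; now intros [|i].
Qed.

Lemma sren_id A : forall r, (forall i, r i = i) -> sren r A = A.
Proof.
induction A; intros r E; cbn; f_equal; auto;
  apply IHA; intros [|i]; cbn; auto.
Qed.

(** Opening a bound variable extends the renaming. This turns renamings into valuations:
    [sren (ncons x r) A] is A with its first variable read as x and the others read through [r]. *)
Lemma sinst_upr r A x : sinst (sren (upr r) A) x = sren (ncons x r) A.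
Proof. unfold sinst; rewrite sren_comp; apply sren_ext; now intros [|i]. Qed.

Lemma sren_sinst r A x : sren r (sinst A x) = sinst (sren (upr r) A) (r x).
Proof.
rewrite sinst_upr; unfold sinst; rewrite sren_comp; apply sren_ext; now intros [|i].
Qed.

Lemma sinst_shift A x : sinst (sren S A) x = A.
Proof. unfold sinst; rewrite sren_comp; now apply sren_id. Qed.

Lemma Delta0_sren A : Delta0 A -> forall r, Delta0 (sren r A).
Proof.
induction 1; intro r; cbn.
- apply D0_bot.
- apply D0_mem.
- apply D0_eq.
- now apply D0_and.
- now apply D0_or.
- now apply D0_imp.
- now apply (D0_all (r a)).
- now apply (D0_ex (r a)).
Qed.

Ltac sren_eq :=
  unfold BAll, BEx; cbn; lazymatch goal with
  | |- All _ = All _ => apply (f_equal All); sren_eq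
  | |- Ex _ = Ex _ => apply (f_equal Ex); sren_eq
  | |- And _ _ = And _ _ => apply (f_equal2 And); sren_eq
  | |- Or _ _ = Or _ _ => apply (f_equal2 Or); sren_eq
  | |- Imp _ _ = Imp _ _ => apply (f_equal2 Imp); sren_eq
  | |- sren _ _ = sren _ _ =>
      repeat rewrite sren_comp; apply sren_ext; now intros [|[|[|[|[|?]]]]]
  | _ => reflexivity
  end.

(** An instance of a scheme is renamed to the instance at the renamed formula. The number of [upr]
    is the number of variables displayed in that formula: one for induction, two for separation,
    three for strong and five for subset collection. *)
Lemma CZFax_sren A : CZFax A -> forall r, CZFax (sren r A).
Proof.
intros [ | | |B D| |B|B|B] r.
- exact czf_ext.
- exact czf_pairing.
- exact czf_union.
- replace (sren _ _) with (All (Ex (All (0 ∈ 1 ≡ 0 ∈ 2 ∧ sren (upr S) (sren (upr (upr r)) B))))).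
  + apply czf_sep; now apply Delta0_sren.
  + sren_eq.
- exact czf_infinity.
- replace (sren _ _) with (All (BAll 0 (sren (upr S) (sren (upr r) B)) ⊃ sren (upr r) B)
      ⊃ All (sren (upr r) B)).
  + apply czf_ind.
  + sren_eq.
- pose proof (czf_strong_coll (sren (upr (upr (upr r))) B)) as H.
  match goal with |- CZFax ?X => match type of H with CZFax ?Y => replace X with Y end end; auto.
  sren_eq.
- pose proof (czf_subset_coll (sren (upr (upr (upr (upr (upr r))))) B)) as H.
  match goal with |- CZFax ?X => match type of H with CZFax ?Y => replace X with Y end end; auto.
  sren_eq.
Qed.

Lemma map_sren_shift r H :
  map (sren (upr r)) (map (sren S) H) = map (sren S) (map (sren r) H).
Proof. rewrite !map_map; apply map_ext; intro A; sren_eq. Qed.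

Lemma CZF_sren H A : H ⊢ A -> forall r, map (sren r) H ⊢ sren r A.
Proof.
induction 1; intro r; cbn in *.
- now apply cz_hyp, in_map.
- now apply cz_ax, CZFax_sren.
- apply cz_refl.
- rewrite sren_sinst; apply cz_leibniz with (r x); auto.
  rewrite <- sren_sinst; auto.
- now apply cz_botE.
- now apply cz_andI.
- now apply cz_andE1 with (sren r B).
- now apply cz_andE2 with (sren r A).
- now apply cz_orI1.
- now apply cz_orI2.
- now apply cz_orE with (sren r A) (sren r B).
- now apply cz_impI.
- now apply cz_impE with (sren r A).
- apply cz_allI; rewrite <- map_sren_shift; auto.
- rewrite sren_sinst; now apply cz_allE, (IHCZF r).
- apply cz_exI with (r x); rewrite <- sren_sinst; auto.
- apply cz_exE with (sren (upr r) A); [apply (IHCZF1 r)|].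
  rewrite <- map_sren_shift.
  replace (sren S (sren r C)) with (sren (upr r) (sren S C)) by sren_eq.
  apply IHCZF2.
Qed.

Lemma CZF_weaken H H' A : incl H H' -> H ⊢ A -> H' ⊢ A.
Proof.
intros i d; revert H' i; induction d; intros H' i.
- now apply cz_hyp, i.
- now apply cz_ax.
- apply cz_refl.
- now apply cz_leibniz with x; auto.
- now apply cz_botE; auto.
- now apply cz_andI; auto.
- now apply cz_andE1 with B; auto.
- now apply cz_andE2 with A; auto.
- now apply cz_orI1; auto.
- now apply cz_orI2; auto.
- apply cz_orE with A B; auto using incl_cons, in_eq, incl_tl.
- apply cz_impI; auto using incl_cons, in_eq, incl_tl.
- now apply cz_impE with A; auto.
- now apply cz_allI, IHd, incl_map.
- now apply cz_allE; auto.
- now apply cz_exI with x; auto.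
- apply cz_exE with A; auto using incl_cons, in_eq, incl_tl, incl_map.
Qed.

(** * Reasoning with names *)

(** Binders do not lower the value and bound indices are counted, so this overestimates the free
    variables; a name at or above it is fresh. *)
Fixpoint bnd (A : sfm) : nat :=
  match A with
  | Bot => 0
  | x ∈ y | x ≐ y => S (max x y)
  | A ∧ B | A ∨ B | A ⊃ B => max (bnd A) (bnd B)
  | All A | Ex A => bnd A
  end%sfm.

Lemma sren_ext_bnd A : forall r r',
  (forall i, i < bnd A -> r i = r' i) -> sren r A = sren r' A.
Proof.
induction A; intros r r' E; cbn in *.
- reflexivity.
- apply (f_equal2 Mem); apply E; lia.
- apply (f_equal2 Eqs); apply E; lia.
- apply (f_equal2 And); [apply IHA1|apply IHA2]; intros; apply E; lia.
- apply (f_equal2 Or); [apply IHA1|apply IHA2]; intros; apply E; lia.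
- apply (f_equal2 Imp); [apply IHA1|apply IHA2]; intros; apply E; lia.
- apply (f_equal All), IHA; intros [|i] l; cbn; auto; f_equal; apply E; lia.
- apply (f_equal Ex), IHA; intros [|i] l; cbn; auto; f_equal; apply E; lia.
Qed.

Lemma bnd_list (H : list sfm) : exists n, forall A, In A H -> bnd A <= n.
Proof.
induction H as [|B H [n IH]].
- exists 0; intros A [].
- exists (bnd B + n); intros A [<-|i]; [lia|].
  specialize (IH _ i); lia.
Qed.

(** The inverse of instantiation at a fresh name: x becomes the bound index 0 and every other name
    is shifted. *)
Definition bindname (x i : nat) : nat := if i =? x then 0 else S i.

Lemma bindname_fresh x A : bnd A <= x -> sren (bindname x) A = sren S A.
Proof.
intro l; apply sren_ext_bnd; intros i j; unfold bindname.
destruct (Nat.eqb_spec i x); lia.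
Qed.

Lemma bindname_sinst x A : bnd A <= x -> sren (bindname x) (sinst A x) = A.
Proof.
intro l; unfold sinst; rewrite sren_comp.
rewrite <- (@sren_id A (fun i => i)) at 2 by reflexivity.
apply sren_ext_bnd; intros [|i] j; cbn; unfold bindname.
- now rewrite Nat.eqb_refl.
- destruct (Nat.eqb_spec i x); lia.
Qed.

(* Premises quantified over all names can be instantiated with a fresh one. *)
Lemma allI G A : (forall x, G ⊢ sinst A x) -> G ⊢ All A.
Proof.
intro h; destruct (bnd_list G) as [n l].
set (x := n + bnd A); specialize (h x).
apply cz_allI.
apply CZF_sren with (r := bindname x) in h.
rewrite bindname_sinst in h by lia.
erewrite map_ext_in; [exact h|].
intros B i; symmetry; apply bindname_fresh; specialize (l _ i); lia.
Qed.

Lemma impI G A B :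
  (forall G', incl G G' -> G' ⊢ A -> G' ⊢ B) -> G ⊢ (A ⊃ B).
Proof. intro h; apply cz_impI, h; [now apply incl_tl|now apply cz_hyp; left]. Qed.

(** The name x is chosen fresh for G, A and also C: [bindname x] then turns the instance back into
    A, and C and G into their shifts, as the primitive rule demands. *)
Lemma exE G A C : G ⊢ Ex A ->
  (forall G', incl G G' -> forall x, G' ⊢ sinst A x -> G' ⊢ C) -> G ⊢ C.
Proof.
intros e h; destruct (bnd_list G) as [n l].
set (x := n + bnd A + bnd C).
apply cz_exE with A; [exact e|].
specialize (h (sinst A x :: G) (incl_tl _ (incl_refl _)) x
  (cz_hyp (in_eq _ _))).
apply CZF_sren with (r := bindname x) in h; cbn in h.
rewrite bindname_sinst, bindname_fresh in h by lia.
erewrite map_ext_in; [exact h|].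
intros B i; symmetry; apply bindname_fresh; specialize (l _ i); lia.
Qed.

Lemma orE G A B C : G ⊢ (A ∨ B) ->
  (forall G', incl G G' -> G' ⊢ A -> G' ⊢ C) ->
  (forall G', incl G G' -> G' ⊢ B -> G' ⊢ C) -> G ⊢ C.
Proof.
intros e h1 h2; apply cz_orE with A B; [exact e|apply h1|apply h2];
  (now apply incl_tl) || now apply cz_hyp; left.
Qed.

Lemma andP G A B : G ⊢ (A ∧ B) <-> (G ⊢ A) /\ (G ⊢ B).
Proof.
split; [intro h; split; [now apply cz_andE1 with B|now apply cz_andE2 with A]|].
intros []; now apply cz_andI.
Qed.

Lemma mp G A B : G ⊢ (A ⊃ B) -> G ⊢ A -> G ⊢ B.
Proof. apply cz_impE. Qed.

Lemma iffI G A B :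
  (forall G', incl G G' -> G' ⊢ A -> G' ⊢ B) ->
  (forall G', incl G G' -> G' ⊢ B -> G' ⊢ A) -> G ⊢ (A ≡ B).
Proof. intros; apply cz_andI; now apply impI. Qed.

Lemma iff1 G A B : G ⊢ (A ≡ B) -> G ⊢ A -> G ⊢ B.
Proof. intros [h _]%andP; now apply mp. Qed.

Lemma iff2 G A B : G ⊢ (A ≡ B) -> G ⊢ B -> G ⊢ A.
Proof. intros [_ h]%andP; now apply mp. Qed.

Lemma BAllE G a A x : G ⊢ BAll a A -> G ⊢ (x ∈ a) -> G ⊢ sinst A x.
Proof. intros h i; exact (mp (cz_allE x h) i). Qed.

Lemma BAllI G a A :
  (forall G', incl G G' -> forall x, G' ⊢ (x ∈ a) -> G' ⊢ sinst A x) -> G ⊢ BAll a A.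
Proof. intro h; apply allI; intro x; apply impI; intros G' i; now apply (h G' i x). Qed.

Lemma BExI G a A x : G ⊢ (x ∈ a) -> G ⊢ sinst A x -> G ⊢ BEx a A.
Proof. intros h i; apply cz_exI with x; now apply cz_andI. Qed.

Lemma BExE G a A C : G ⊢ BEx a A ->
  (forall G', incl G G' -> forall x, G' ⊢ (x ∈ a) -> G' ⊢ sinst A x -> G' ⊢ C) -> G ⊢ C.
Proof.
intros e h; apply (exE e); intros G' i x [h1 h2]%andP; now apply (h G' i x).
Qed.

Lemma eq_sym G x y : G ⊢ (x ≐ y) -> G ⊢ (y ≐ x).
Proof.
intro h; apply (@cz_leibniz G (0 ≐ S x) x y h); apply cz_refl.
Qed.

Lemma eq_trans G x y z : G ⊢ (x ≐ y) -> G ⊢ (y ≐ z) -> G ⊢ (x ≐ z).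
Proof. intros h k; exact (@cz_leibniz G (S x ≐ 0) y z k h). Qed.

Lemma ncons_cong G x r r' : (forall i, G ⊢ (r i ≐ r' i)) ->
  forall i, G ⊢ (ncons x r i ≐ ncons x r' i).
Proof. intros E [|i]; cbn; [apply cz_refl|apply E]. Qed.

Lemma eqs_weaken G G' (r r' : nat -> nat) : incl G G' -> (forall i, G ⊢ (r i ≐ r' i)) ->
  forall i, G' ⊢ (r i ≐ r' i).
Proof. intros j E i; exact (CZF_weaken j (E i)). Qed.

(** [cz_leibniz] replaces one variable; here all are replaced at once. Congruence of a definable
    predicate follows by writing its instances as renamings of one fixed formula. *)
Lemma sren_cong A : forall G r r',
  (forall i, G ⊢ (r i ≐ r' i)) -> G ⊢ sren r A -> G ⊢ sren r' A.
Proof.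
induction A; intros G r r' E h; cbn in *.
- exact h.
- apply (@cz_leibniz G (0 ∈ S (r' n0)) (r n)); [apply E|].
  exact (@cz_leibniz G (S (r n) ∈ 0) (r n0) (r' n0) (E n0) h).
- apply eq_trans with (r n); [apply eq_sym, E|].
  now apply eq_trans with (r n0).
- apply andP in h as []; apply andP; eauto.
- apply (orE h); intros G' i k; [apply cz_orI1|apply cz_orI2];
    eauto using eqs_weaken.
- apply impI; intros G' i k.
  apply IHA2 with r; [eauto using eqs_weaken|].
  apply mp with (sren r A1); [now apply (CZF_weaken i)|].
  apply IHA1 with r'; [|exact k].
  intro j; apply eq_sym; eauto using eqs_weaken.
- apply allI; intro x; rewrite sinst_upr.
  apply IHA with (ncons x r); [now apply ncons_cong|].
  rewrite <- sinst_upr; now apply cz_allE.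
- apply (exE h); intros G' i x k; rewrite sinst_upr in k.
  apply cz_exI with x; rewrite sinst_upr.
  apply IHA with (ncons x r); [|exact k].
  apply ncons_cong; eauto using eqs_weaken.
Qed.

Lemma sren_BAll r a A : sren r (BAll a A) = BAll (r a) (sren (upr r) A).
Proof. reflexivity. Qed.
Lemma sren_BEx r a A : sren r (BEx a A) = BEx (r a) (sren (upr r) A).
Proof. reflexivity. Qed.
Lemma sren_isEmpty r z : sren r (isEmpty z) = isEmpty (r z).
Proof. reflexivity. Qed.
Lemma sren_isSucc r z x : sren r (isSucc z x) = isSucc (r z) (r x).
Proof. reflexivity. Qed.
Lemma sren_isUpair r z x y : sren r (isUpair z x y) = isUpair (r z) (r x) (r y).
Proof. reflexivity. Qed.
Lemma sren_isPair r z x y : sren r (isPair z x y) = isPair (r z) (r x) (r y).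
Proof. reflexivity. Qed.
Lemma sren_pairIn r x y f : sren r (pairIn x y f) = pairIn (r x) (r y) (r f).
Proof. reflexivity. Qed.
Lemma sren_isOmega r z : sren r (isOmega z) = isOmega (r z).
Proof. reflexivity. Qed.
Lemma sren_isProd r z a b : sren r (isProd z a b) = isProd (r z) (r a) (r b).
Proof. reflexivity. Qed.
Lemma sren_isFunction r f a b :
  sren r (isFunction f a b) = isFunction (r f) (r a) (r b).
Proof. reflexivity. Qed.
Lemma sren_isFunSet r z a b : sren r (isFunSet z a b) = isFunSet (r z) (r a) (r b).
Proof. reflexivity. Qed.

Create HintDb sren.
#[global] Hint Rewrite sren_BAll sren_BEx sren_isEmpty sren_isSucc sren_isUpair
  sren_isPair sren_pairIn sren_isOmega sren_isProd sren_isFunction sren_isFunSet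
  sinst_shift : sren.

Ltac ssg := rewrite ?sinst_upr; unfold sinst; cbn [sren upr ncons Nat.add];
  repeat (progress autorewrite with sren; cbn [sren upr ncons Nat.add]).
Ltac ssin h := rewrite ?sinst_upr in h; unfold sinst in h;
  cbn [sren upr ncons Nat.add] in h;
  repeat (progress autorewrite with sren in h; cbn [sren upr ncons Nat.add] in h).

(* A derivation [CZF G A] among the Coq hypotheses plays the role of an object
   hypothesis; [weaken_hyps i] moves all of them to a larger list. *)
Ltac weaken_hook i := fail.
Ltac weaken_hyps i :=
  match type of i with
  | incl ?G ?G' =>
      repeat match goal with
        | h : CZF G _ |- _ => apply (CZF_weaken i) in h
        | h : forall x : nat, CZF G _ |- _ =>
            let t := fresh in pose proof (fun x => CZF_weaken i (h x)) as t;
            clear h; rename t into h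
        | _ => weaken_hook i
        end;
      clear i; try (clear G; rename G' into G)
  end.

Ltac incls :=
  let B := fresh in let m := fresh in
  intros B m; repeat match goal with i : incl _ _ |- _ => apply i in m end; exact m.

Tactic Notation "iimp" ident(h) :=
  let G' := fresh "G" in let i := fresh "i" in
  apply impI; intros G' i h; weaken_hyps i.
Tactic Notation "iall" ident(x) := apply allI; intro x; ssg.
Tactic Notation "iex" uconstr(H) ident(x) ident(h) :=
  let G' := fresh "G" in let i := fresh "i" in
  apply (exE H); intros G' i x h; weaken_hyps i; ssin h.
Tactic Notation "ibex" uconstr(H) ident(x) ident(hx) ident(h) :=
  let G' := fresh "G" in let i := fresh "i" in
  apply (BExE H); intros G' i x hx h; weaken_hyps i; ssin h.
Tactic Notation "iball" ident(x) ident(h) :=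
  let G' := fresh "G" in let i := fresh "i" in
  apply BAllI; intros G' i x h; weaken_hyps i; ssg.
Tactic Notation "ior" uconstr(H) ident(h) :=
  let G' := fresh "G" in let i := fresh "i" in
  apply (orE H); intros G' i h; weaken_hyps i.
Tactic Notation "iiff" ident(h) :=
  let G' := fresh "G" in let i := fresh "i" in
  apply iffI; intros G' i h; weaken_hyps i.
Tactic Notation "use" constr(x) := apply cz_exI with x; ssg.
Tactic Notation "ispec" constr(H) constr(x) "as" simple_intropattern(p) :=
  let h := fresh in pose proof (cz_allE x H) as h; ssin h; revert h; intros p.
Tactic Notation "ibspec" constr(H) constr(x) "as" simple_intropattern(p) :=
  let h := fresh in pose proof (BAllE (x := x) H) as h; ssin h;
  specialize (h ltac:(eassumption)); revert h; intros p.

Ltac eqt := solve [ assumption | apply cz_refl | apply eq_sym; assumption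
                  | eauto 4 using cz_refl, eq_sym, eq_trans ].

Ltac names := intros [|[|[|[|?]]]]; cbn; assumption || apply cz_refl.
Notation ids := (fun i : nat => i).

(** * Extensionality and congruence *)

Lemma set_ext G a b :
  (forall G', incl G G' -> forall u, G' ⊢ u ∈ a -> G' ⊢ u ∈ b) ->
  (forall G', incl G G' -> forall u, G' ⊢ u ∈ b -> G' ⊢ u ∈ a) -> G ⊢ a ≐ b.
Proof.
intros h k; pose proof (cz_ax G czf_ext) as e.
ispec e a as e1; ispec e1 b as e2; apply (mp e2).
apply allI; intro u; apply iffI; intros G' i; ssg; eauto.
Qed.

Tactic Notation "iext" ident(u) ident(h) :=
  let G' := fresh "G" in let i := fresh "i" in
  apply set_ext; intros G' i u h; weaken_hyps i.

Lemma mem_cong G x y x' y' :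
  G ⊢ x ≐ x' -> G ⊢ y ≐ y' -> G ⊢ x ∈ y -> G ⊢ x' ∈ y'.
Proof.
intros; apply (@sren_cong (0 ∈ 1) G (ncons x (ncons y ids))
  (ncons x' (ncons y' ids))); [names|assumption].
Qed.

Lemma isEmpty_cong G x x' : G ⊢ x ≐ x' -> G ⊢ isEmpty x -> G ⊢ isEmpty x'.
Proof.
intros; apply (@sren_cong (isEmpty 0) G (ncons x ids)
  (ncons x' ids)); [names|assumption].
Qed.

Lemma isSucc_cong G x y x' y' :
  G ⊢ x ≐ x' -> G ⊢ y ≐ y' -> G ⊢ isSucc x y -> G ⊢ isSucc x' y'.
Proof.
intros; apply (@sren_cong (isSucc 0 1) G (ncons x (ncons y ids))
  (ncons x' (ncons y' ids))); [names|assumption].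
Qed.

Lemma isUpair_cong G x y z x' y' z' : G ⊢ x ≐ x' -> G ⊢ y ≐ y' -> G ⊢ z ≐ z' ->
  G ⊢ isUpair x y z -> G ⊢ isUpair x' y' z'.
Proof.
intros; apply (@sren_cong (isUpair 0 1 2) G (ncons x (ncons y (ncons z ids)))
  (ncons x' (ncons y' (ncons z' ids)))); [names|assumption].
Qed.

Lemma isPair_cong G x y z x' y' z' : G ⊢ x ≐ x' -> G ⊢ y ≐ y' -> G ⊢ z ≐ z' ->
  G ⊢ isPair x y z -> G ⊢ isPair x' y' z'.
Proof.
intros; apply (@sren_cong (isPair 0 1 2) G (ncons x (ncons y (ncons z ids)))
  (ncons x' (ncons y' (ncons z' ids)))); [names|assumption].
Qed.

Lemma pairIn_cong G x y z x' y' z' : G ⊢ x ≐ x' -> G ⊢ y ≐ y' -> G ⊢ z ≐ z' ->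
  G ⊢ pairIn x y z -> G ⊢ pairIn x' y' z'.
Proof.
intros; apply (@sren_cong (pairIn 0 1 2) G (ncons x (ncons y (ncons z ids)))
  (ncons x' (ncons y' (ncons z' ids)))); [names|assumption].
Qed.

Lemma isFunction_cong G x y z x' y' z' : G ⊢ x ≐ x' -> G ⊢ y ≐ y' -> G ⊢ z ≐ z' ->
  G ⊢ isFunction x y z -> G ⊢ isFunction x' y' z'.
Proof.
intros; apply (@sren_cong (isFunction 0 1 2) G (ncons x (ncons y (ncons z ids)))
  (ncons x' (ncons y' (ncons z' ids)))); [names|assumption].
Qed.

(** * Pairs *)

Lemma upair_ex G x y : G ⊢ Ex (isUpair 0 (S x) (S y)).
Proof.
pose proof (cz_ax G czf_pairing) as e.
ispec e x as e1; ispec e1 y as e2; exact e2.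
Qed.

Lemma mem_upair G z x y u : G ⊢ isUpair z x y -> G ⊢ (u ∈ z ≡ u ≐ x ∨ u ≐ y).
Proof. exact (cz_allE u). Qed.

Lemma upair_mem1 G z x y : G ⊢ isUpair z x y -> G ⊢ x ∈ z.
Proof. intro h; apply (iff2 (mem_upair x h)), cz_orI1, cz_refl. Qed.

Lemma upair_mem2 G z x y : G ⊢ isUpair z x y -> G ⊢ y ∈ z.
Proof. intro h; apply (iff2 (mem_upair y h)), cz_orI2, cz_refl. Qed.

Lemma upair_uniq G z z' x y : G ⊢ isUpair z x y -> G ⊢ isUpair z' x y -> G ⊢ z ≐ z'.
Proof.
intros h k; iext u m.
- apply (iff2 (mem_upair u k)), (iff1 (mem_upair u h) m).
- apply (iff2 (mem_upair u h)), (iff1 (mem_upair u k) m).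
Qed.

Lemma sing_mem G z x u : G ⊢ isUpair z x x -> G ⊢ u ∈ z -> G ⊢ u ≐ x.
Proof. intros h m; ior (iff1 (mem_upair u h) m) e; exact e. Qed.

Lemma mem_pair G z x y u :
  G ⊢ isPair z x y -> G ⊢ (u ∈ z ≡ isUpair u x x ∨ isUpair u x y).
Proof. exact (cz_allE u). Qed.

Lemma pair_ex G x y : G ⊢ Ex (isPair 0 (S x) (S y)).
Proof.
iex (upair_ex _ x x) p hp; iex (upair_ex _ x y) q hq; iex (upair_ex _ p q) z hz.
use z; iall u; iiff h.
- ior (iff1 (mem_upair u hz) h) e; [apply cz_orI1|apply cz_orI2].
  + apply isUpair_cong with p x x; eqt.
  + apply isUpair_cong with q x y; eqt.
- apply (iff2 (mem_upair u hz)); ior h e; [apply cz_orI1|apply cz_orI2];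
    eapply upair_uniq; eassumption.
Qed.

Lemma pair_uniq G z z' x y : G ⊢ isPair z x y -> G ⊢ isPair z' x y -> G ⊢ z ≐ z'.
Proof.
intros h k; iext u m.
- apply (iff2 (mem_pair u k)), (iff1 (mem_pair u h) m).
- apply (iff2 (mem_pair u h)), (iff1 (mem_pair u k) m).
Qed.

(** The singleton {x} belongs to z, so it is {x'} or {x', y'}; in both cases x' is a member of
    {x}. *)
Lemma pair_inj1 G z x y x' y' :
  G ⊢ isPair z x y -> G ⊢ isPair z x' y' -> G ⊢ x ≐ x'.
Proof.
intros h k; iex (upair_ex _ x x) p hp.
pose proof (iff2 (mem_pair p h) (cz_orI1 _ hp)) as m.
apply eq_sym, (sing_mem hp).
ior (iff1 (mem_pair p k) m) e; eauto using upair_mem1.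
Qed.

Lemma pair_inj2 G z x y x' y' :
  G ⊢ isPair z x y -> G ⊢ isPair z x' y' -> G ⊢ y ≐ y'.
Proof.
intros h k; pose proof (pair_inj1 h k) as ex.
(* Equality of sets is not decidable, so the degenerate case y = x cannot be split off. It is
   isolated as an implication and used only where a disjunction delivers y = x. *)
assert (A : G ⊢ (y ≐ x ⊃ y ≐ y')).
{ iimp e; iex (upair_ex _ x' y') q hq.
  pose proof (iff2 (mem_pair q k) (cz_orI2 _ hq)) as m.
  ior (iff1 (mem_pair q h) m) f.
  - pose proof (sing_mem f (upair_mem2 hq)); eqt.
  - ior (iff1 (mem_upair y' f) (upair_mem2 hq)) g; eqt. }
iex (upair_ex _ x y) q hq.
pose proof (iff2 (mem_pair q h) (cz_orI2 _ hq)) as m.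
ior (iff1 (mem_pair q k) m) f.
- pose proof (sing_mem f (upair_mem2 hq)); apply (mp A); eqt.
- ior (iff1 (mem_upair y f) (upair_mem2 hq)) g; [apply (mp A)|]; eqt.
Qed.

Lemma pairIn_intro G p x y f : G ⊢ isPair p x y -> G ⊢ p ∈ f -> G ⊢ pairIn x y f.
Proof. intros h m; now apply BExI with p. Qed.

Lemma pairIn_mem G p x y f : G ⊢ isPair p x y -> G ⊢ pairIn x y f -> G ⊢ p ∈ f.
Proof.
intros h m; ibex m q hq k; apply mem_cong with q f; auto using cz_refl.
eapply pair_uniq; eassumption.
Qed.

(** * Successor and the natural numbers *)

Lemma empty_ex_false G z u C : G ⊢ isEmpty z -> G ⊢ u ∈ z -> G ⊢ C.
Proof. intros h m; apply cz_botE; exact (BAllE h m). Qed.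

Lemma empty_uniq G z z' : G ⊢ isEmpty z -> G ⊢ isEmpty z' -> G ⊢ z ≐ z'.
Proof. intros h k; iext u m; [exact (empty_ex_false _ h m)|exact (empty_ex_false _ k m)]. Qed.

Lemma mem_succ G z x u : G ⊢ isSucc z x -> G ⊢ (u ∈ z ≡ u ∈ x ∨ u ≐ x).
Proof. exact (cz_allE u). Qed.

Lemma succ_mem G z x : G ⊢ isSucc z x -> G ⊢ x ∈ z.
Proof. intro h; apply (iff2 (mem_succ x h)), cz_orI2, cz_refl. Qed.

Lemma succ_uniq G z z' x : G ⊢ isSucc z x -> G ⊢ isSucc z' x -> G ⊢ z ≐ z'.
Proof.
intros h k; iext u m.
- apply (iff2 (mem_succ u k)), (iff1 (mem_succ u h) m).
- apply (iff2 (mem_succ u h)), (iff1 (mem_succ u k) m).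
Qed.

Lemma union_ex G a : G ⊢ Ex (All (0 ∈ 1 ≡ BEx (2 + a) (1 ∈ 0))).
Proof. pose proof (cz_ax G czf_union) as e; ispec e a as e1; exact e1. Qed.

(** h ∪ {p} is the union of {h, {p}}. It provides successors and, later, the extension of a partial
    recursion by one pair. *)
Lemma adjoin_ex G h p : G ⊢ Ex (All (0 ∈ 1 ≡ 0 ∈ 2 + h ∨ 0 ≐ 2 + p)).
Proof.
iex (upair_ex _ p p) s hs; iex (upair_ex _ h s) q hq; iex (union_ex _ q) z hz.
use z; iall u; ispec hz u as hu; iiff k.
- pose proof (iff1 hu k) as h1; ibex h1 v hv k1.
  ior (iff1 (mem_upair v hq) hv) e.
  + apply cz_orI1, mem_cong with u v; eqt.
  + apply cz_orI2, (sing_mem hs), mem_cong with u v; eqt.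
- apply (iff2 hu); ior k e.
  + apply BExI with h; [eapply upair_mem1|]; eassumption.
  + apply BExI with s; [eapply upair_mem2; eassumption|ssg].
    apply mem_cong with p s; [eqt|eqt|eapply upair_mem1; eassumption].
Qed.

Lemma succ_ex G x : G ⊢ Ex (isSucc 0 (S x)).
Proof. exact (adjoin_ex G x x). Qed.

Lemma set_ind G A :
  (forall G', incl G G' -> forall x, G' ⊢ BAll x A -> G' ⊢ sinst A x) ->
  forall x, G ⊢ sinst A x.
Proof.
intros h x; apply cz_allE, (mp (cz_ax G (czf_ind A))).
iall y; apply impI; intros G' i k.
replace (sren (ncons y ids) A) with (sinst A y) by reflexivity.
apply h; auto.
replace A with (sren (upr (ncons y ids)) (sren (upr S) A)); [exact k|].
rewrite sren_comp; apply sren_id; now intros [|j].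
Qed.

(** By ∈-induction: a cycle between u and a member v of u is also a cycle at v, which the induction
    hypothesis excludes. *)
Lemma mem_asym G x y C : G ⊢ x ∈ y -> G ⊢ y ∈ x -> G ⊢ C.
Proof.
assert (H : G ⊢ sinst (All (0 ∈ 1 ∧ 1 ∈ 0 ⊃ Bot)) x).
{ apply set_ind; intros G' _ u h; ssg; iall v; iimp k; apply andP in k as [k1 k2].
  ibspec h v as h1; ispec h1 u as h2.
  apply (mp h2); now apply andP. }
intros h k; apply cz_botE; ssin H; ispec H y as H1; apply (mp H1); now apply andP.
Qed.

(** Each of x and y lies in z, hence is a member of the other or equal to it; membership both ways
    contradicts [mem_asym]. *)
Lemma succ_inj G z x y : G ⊢ isSucc z x -> G ⊢ isSucc z y -> G ⊢ x ≐ y.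
Proof.
intros h k.
ior (iff1 (mem_succ x k) (succ_mem h)) e; [|exact e].
ior (iff1 (mem_succ y h) (succ_mem k)) f; [|eqt].
exact (mem_asym _ e f).
Qed.

Lemma mem_omega G w u :
  G ⊢ isOmega w -> G ⊢ (u ∈ w ≡ isEmpty u ∨ BEx w (isSucc (S u) 0)).
Proof. exact (cz_allE u). Qed.

Lemma omega_zero G w u : G ⊢ isOmega w -> G ⊢ isEmpty u -> G ⊢ u ∈ w.
Proof. intros h k; now apply (iff2 (mem_omega u h)), cz_orI1. Qed.

Lemma omega_succ G w u v : G ⊢ isOmega w -> G ⊢ v ∈ w -> G ⊢ isSucc u v -> G ⊢ u ∈ w.
Proof. intros h m k; apply (iff2 (mem_omega u h)), cz_orI2; now apply BExI with v. Qed.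

(** This is ∈-induction for [0 ∈ S w ⊃ A]: a member of w is empty or the successor of some v in w,
    and v is a member of that successor. *)
Lemma omega_ind G A w : G ⊢ isOmega w ->
  (forall G', incl G G' -> forall u, G' ⊢ isEmpty u -> G' ⊢ sinst A u) ->
  (forall G', incl G G' -> forall u v, G' ⊢ v ∈ w -> G' ⊢ isSucc u v ->
     G' ⊢ sinst A v -> G' ⊢ sinst A u) ->
  forall u, G ⊢ u ∈ w -> G ⊢ sinst A u.
Proof.
intros hw h0 hS u; apply mp.
change (G ⊢ sinst (0 ∈ S w ⊃ A) u); apply set_ind; intros G1 i1 x IH.
apply (CZF_weaken i1) in hw.
apply impI; intros G2 i2 m; cbn in m.
apply (CZF_weaken i2) in hw, IH.
apply (orE (iff1 (mem_omega x hw) m)); intros G3 i3 k.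
- apply h0; eauto using incl_tran.
- apply (BExE k); intros G4 i4 v hv s; ssin s.
  apply hS with v; eauto using incl_tran.
  assert (i5 : incl G2 G4) by eauto using incl_tran.
  apply mp with (v ∈ w); [|exact hv].
  exact (BAllE (CZF_weaken i5 IH) (succ_mem s)).
Qed.

Lemma omega_incl G w w' : G ⊢ isOmega w -> G ⊢ isOmega w' ->
  forall u, G ⊢ u ∈ w -> G ⊢ u ∈ w'.
Proof.
intros h k u m; apply (@omega_ind G (0 ∈ S w') w h); auto; intros G' i; weaken_hyps i; intros v.
- apply omega_zero, k.
- intros x _ s hx; exact (omega_succ k hx s).
Qed.

Lemma omega_uniq G w w' : G ⊢ isOmega w -> G ⊢ isOmega w' -> G ⊢ w ≐ w'.
Proof. intros h k; iext u m; eauto using omega_incl. Qed.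

Lemma omega_ex G : G ⊢ Ex (isOmega 0).
Proof. exact (cz_ax G czf_infinity). Qed.

Lemma empty_ex G : G ⊢ Ex (isEmpty 0).
Proof.
iex (omega_ex _) w hw.
pose proof (cz_ax G (czf_sep D0_bot)) as e; ispec e w as e1; iex e1 z hz.
use z; iball u m; ispec hz u as k.
exact (cz_andE2 (iff1 k m)).
Qed.

(** * Functions given by functional formulas *)

Lemma sren_exact G A r r' : (forall i, r i = r' i) -> G ⊢ sren r A -> G ⊢ sren r' A.
Proof. intros e h; now rewrite <- (sren_ext A e). Qed.

Notation inst2 A y x := (sren (ncons y (ncons x ids)) A).

(** In the axiom the formula may mention a as a third variable, and [upr (upr S)] skips it. In the
    second clause the element of b is bound outside, so indices 0 and 1 of A are exchanged. *)
Lemma strong_coll G A a C : G ⊢ BAll a (Ex A) ->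
  (forall G', incl G G' -> forall b, G' ⊢ BAll a (BEx (S b) A) ->
     G' ⊢ BAll b (BEx (S a) (sren (ncons 1 (ncons 0 (fun i => 2 + i))) A)) -> G' ⊢ C) ->
  G ⊢ C.
Proof.
intros h k.
pose proof (cz_ax G (czf_strong_coll (sren (upr (upr S)) A))) as e.
ispec e a as e1; rewrite ?sren_comp in e1.
apply (exE (mp e1 ltac:(
  refine (eq_ind _ (fun X => G ⊢ BAll a (Ex X)) h _ _);
  rewrite <- (@sren_id A ids) at 1 by reflexivity; sren_eq))).
intros G' i b j; apply (k G' i b); ssin j; apply andP in j as [j1 j2].
- refine (eq_ind _ (fun X => G' ⊢ BAll a (BEx (S b) X)) j1 _ _).
  rewrite <- (@sren_id A ids) by reflexivity; sren_eq.
- refine (eq_ind _ (fun X => G' ⊢ BAll b (BEx (S a) X)) j2 _ _); sren_eq.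
Qed.

(** f = {(x, y) | x ∈ a, A}, where indices 0 and 1 of A stand for y and x *)
Definition isGraph (f a : nat) (A : sfm) : sfm :=
  All (0 ∈ S f ≡ BEx (S a) (Ex (sren (ncons 0 (ncons 1 (fun i => 3 + i))) A
                                ∧ isPair 2 1 0))).

Lemma sren_isGraph r f a A :
  sren r (isGraph f a A) = isGraph (r f) (r a) (sren (upr (upr r)) A).
Proof. unfold isGraph; sren_eq. Qed.
#[global] Hint Rewrite sren_isGraph : sren.

Lemma inst2_cong G A x y x' y' :
  G ⊢ x ≐ x' -> G ⊢ y ≐ y' -> G ⊢ inst2 A y x -> G ⊢ inst2 A y' x'.
Proof. intros ? ?; apply sren_cong; names. Qed.

Lemma graph_pairE G f a A x y : G ⊢ isGraph f a A -> G ⊢ pairIn x y f ->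
  (G ⊢ x ∈ a) /\ (G ⊢ inst2 A y x).
Proof.
intros h k; apply andP.
ibex k p m hp; ispec h p as e; pose proof (iff1 e m) as e1.
ibex e1 x1 hx1 e2; iex e2 y1 e3; rewrite ?sren_comp in e3.
apply andP in e3 as [e3 e4].
pose proof (pair_inj1 hp e4); pose proof (pair_inj2 hp e4).
apply andP; split; [apply mem_cong with x1 a; eqt|].
apply inst2_cong with x1 y1; [eqt|eqt|].
revert e3; apply sren_exact; now intros [|[|?]].
Qed.

Lemma graph_pairI G f a A x y :
  G ⊢ isGraph f a A -> G ⊢ x ∈ a -> G ⊢ inst2 A y x -> G ⊢ pairIn x y f.
Proof.
intros h m k; iex (pair_ex _ x y) p hp; apply pairIn_intro with p; [exact hp|].
ispec h p as e; apply (iff2 e); apply BExI with x; [exact m|ssg].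
use y; apply andP; split; [|exact hp].
rewrite ?sren_comp; revert k; apply sren_exact; now intros [|[|?]].
Qed.

(** Strong collection is applied to the relation between x and the pairs (x, y) with A. Every member
    of the resulting b is then such a pair. Conversely b contains some (x, y') for each x in a, and
    uniqueness forces y' = y. *)
Lemma graph_ex G a A : G ⊢ BAll a (Ex A) ->
  (forall G', incl G G' -> forall x y y', G' ⊢ x ∈ a ->
     G' ⊢ inst2 A y x -> G' ⊢ inst2 A y' x -> G' ⊢ y ≐ y') ->
  G ⊢ Ex (isGraph 0 (S a) (sren (upr (upr S)) A)).
Proof.
intros h u.
apply (@strong_coll G (Ex (sren (ncons 0 (ncons 2 (fun i => 3 + i))) A ∧ isPair 1 2 0)) a).
{ iball x m; ibspec h x as k; iex k y e; iex (pair_ex _ x y) p hp.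
  use p; use y; apply andP; split; [|exact hp].
  rewrite ?sren_comp; revert e; rewrite ?sren_comp; apply sren_exact; now intros [|[|?]]. }
intros G1 i1 b H1 H2; use b; iall p.
apply iffI; intros G2 i2 k; apply (CZF_weaken i2) in H1, H2.
- ibspec H2 p as k1; refine (eq_ind _ (fun X => G2 ⊢ BEx a (Ex (X ∧ _))) k1 _ _); sren_eq.
- apply (BExE k); intros G3 i3 x hx k1; ssin k1; apply (CZF_weaken i3) in H1, H2.
  apply (exE k1); intros G4 i4 y k2; ssin k2; apply (CZF_weaken i4) in H1, H2, hx.
  ibspec H1 x as k3; ssin k3.
  apply (BExE k3); intros G5 i5 p' hp' k4; ssin k4; apply (CZF_weaken i5) in H1, H2, hx, k2.
  apply (exE k4); intros G6 i6 y' k5; ssin k5; apply (CZF_weaken i6) in hp', hx, k2.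
  apply andP in k5 as [k5 k6]; apply andP in k2 as [k2 k7].
  assert (e : G6 ⊢ y' ≐ y).
  { apply (u G6) with x; [incls|exact hx|..]; [revert k5|revert k2];
      rewrite ?sren_comp; apply sren_exact; now intros [|[|?]]. }
  apply mem_cong with p' b; [|eqt|exact hp'].
  eapply pair_uniq; [|exact k7]; apply isPair_cong with p' x y'; eqt.
Qed.

(** * Functions *)

Lemma fun_mem G f a b p : G ⊢ isFunction f a b -> G ⊢ p ∈ f ->
  G ⊢ BEx a (BEx (S b) (isPair (2 + p) 1 0)).
Proof. intros [h _]%andP m; ibspec h p as k; exact k. Qed.

Lemma fun_total G f a b x : G ⊢ isFunction f a b -> G ⊢ x ∈ a ->
  G ⊢ BEx b (pairIn (S x) 0 (S f)).
Proof. intros [_ h]%andP m; ibspec h x as k; exact (cz_andE1 k). Qed.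

Lemma fun_dom G f a b x y : G ⊢ isFunction f a b -> G ⊢ pairIn x y f ->
  (G ⊢ x ∈ a) /\ (G ⊢ y ∈ b).
Proof.
intros h k; apply andP; ibex k p m hp.
ibex (fun_mem h m) x1 hx e; ibex e y1 hy e1.
pose proof (pair_inj1 hp e1); pose proof (pair_inj2 hp e1).
apply andP; split; [apply mem_cong with x1 a|apply mem_cong with y1 b]; eqt.
Qed.

Lemma fun_uniq G f a b x y y' : G ⊢ isFunction f a b ->
  G ⊢ pairIn x y f -> G ⊢ pairIn x y' f -> G ⊢ y ≐ y'.
Proof.
intros h k k'; destruct (fun_dom h k) as [m _].
apply andP in h as [_ h]; ibspec h x as e; apply cz_andE2 in e.
ispec e y as e1; ispec e1 y' as e2; apply (mp e2); now apply andP.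
Qed.

Lemma fun_incl G f a b g p : G ⊢ isFunction f a b ->
  G ⊢ All (All (pairIn 1 0 (2 + f) ⊃ pairIn 1 0 (2 + g))) -> G ⊢ p ∈ f -> G ⊢ p ∈ g.
Proof.
intros h k m; ibex (fun_mem h m) x hx e; ibex e y hy hp.
ispec k x as k1; ispec k1 y as k2.
apply (pairIn_mem hp), (mp k2); now apply pairIn_intro with p.
Qed.

Lemma functionI G f a b :
  (forall G', incl G G' -> forall p, G' ⊢ p ∈ f ->
     G' ⊢ BEx a (BEx (S b) (isPair (2 + p) 1 0))) ->
  (forall G', incl G G' -> forall x, G' ⊢ x ∈ a -> G' ⊢ BEx b (pairIn (S x) 0 (S f))) ->
  (forall G', incl G G' -> forall x y y', G' ⊢ x ∈ a ->
     G' ⊢ pairIn x y f -> G' ⊢ pairIn x y' f -> G' ⊢ y ≐ y') ->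
  G ⊢ isFunction f a b.
Proof.
intros h1 h2 h3; apply andP; split.
- apply BAllI; intros; ssg; eauto.
- apply BAllI; intros G1 i1 x hx; ssg; apply andP; split; [apply h2; auto|].
  iall y; iall y'; apply impI; intros G2 i2 k; apply andP in k as [k k'].
  apply h3 with x; [incls|eauto using CZF_weaken..].
Qed.

Lemma graph_function G f a b A : G ⊢ isGraph f a A ->
  G ⊢ BAll a (BEx (S b) A) ->
  (forall G', incl G G' -> forall x y y', G' ⊢ x ∈ a ->
     G' ⊢ inst2 A y x -> G' ⊢ inst2 A y' x -> G' ⊢ y ≐ y') ->
  G ⊢ isFunction f a b.
Proof.
intros hf h u.
assert (E : forall G' x y y', incl G G' -> G' ⊢ inst2 A y x ->
  G' ⊢ inst2 A y' x -> G' ⊢ x ∈ a -> G' ⊢ y ≐ y') by eauto.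
apply functionI; intros G1 i1; apply (CZF_weaken i1) in h, hf.
- intros p m; ispec hf p as k; pose proof (iff1 k m) as k1.
  apply (BExE k1); intros G2 i2 x hx k2; ssin k2; apply (CZF_weaken i2) in h, hf.
  apply (exE k2); intros G3 i3 y k3; ssin k3; apply (CZF_weaken i3) in h, hf, hx.
  apply andP in k3 as [k3 k4].
  (* [A] alone does not place y in b. Some y' in b satisfies it as well, and uniqueness identifies
     the two. *)
  ibspec h x as k5; apply (BExE k5); intros G4 i4 y' hy' k6; ssin k6;
    apply (CZF_weaken i4) in hx, k3, k4.
  apply BExI with x; [exact hx|ssg]; apply BExI with y'; [exact hy'|ssg].
  apply isPair_cong with p x y; [eqt|eqt| |exact k4].
  apply (E G4 x); [incls| | |exact hx]; [revert k3|revert k6];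
    rewrite ?sren_comp; apply sren_exact; now intros [|[|?]].
- intros x hx; ibspec h x as k; apply (BExE k); intros G2 i2 y hy k1; ssin k1.
  apply (CZF_weaken i2) in hx, hf.
  apply BExI with y; [exact hy|ssg]; apply (graph_pairI hf hx).
  rewrite ?sren_comp in k1; revert k1; apply sren_exact; now intros [|[|?]].
- intros x y y' hx k k'; apply (graph_pairE hf) in k as [_ k], k' as [_ k']; eauto.
Qed.

(** * Products and function sets *)

(** For a fixed x, strong collection over b gives {x} × b. A second collection over a gathers these
    sets, and their union is the product. *)
Lemma prod_ex G a b : G ⊢ Ex (isProd 0 (S a) (S b)).
Proof.
apply (@strong_coll G (All (0 ∈ 1 ≡ BEx (3 + b) (isPair 1 3 0))) a).
{ iball x hx.
  apply (@strong_coll G (isPair 0 (2 + x) 1) b).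
  - iball y hy; exact (pair_ex _ _ _).
  - intros G1 i1 c; weaken_hyps i1; intros H1 H2; ssin H1; ssin H2.
    use c; iall p; iiff h.
    + ibspec H2 p as k; exact k.
    + ibex h y hy k; ibspec H1 y as k1; ibex k1 p' hp' k2.
      apply mem_cong with p' c; [eapply pair_uniq; eassumption|eqt|exact hp']. }
intros G1 i1 d; weaken_hyps i1; intros H1 H2; ssin H1; ssin H2.
iex (union_ex _ d) z hz; use z; iall p; ispec hz p as hp; iiff h.
- pose proof (iff1 hp h) as k; ibex k c hc k1.
  ibspec H2 c as k2; ibex k2 x hx k3; ispec k3 p as k4.
  apply BExI with x; [exact hx|ssg]; exact (iff1 k4 k1).
- apply (iff2 hp); ibex h x hx k; ibspec H1 x as k1; ibex k1 c hc k2.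
  apply BExI with c; [exact hc|ssg]; ispec k2 p as k3; exact (iff2 k3 k).
Qed.

Lemma mem_prod G z a b p :
  G ⊢ isProd z a b -> G ⊢ (p ∈ z ≡ BEx a (BEx (S b) (isPair (2 + p) 1 0))).
Proof. intro h; ispec h p as k; exact k. Qed.

Lemma prod_pair G z a b p x y :
  G ⊢ isProd z a b -> G ⊢ x ∈ a -> G ⊢ y ∈ b -> G ⊢ isPair p x y -> G ⊢ p ∈ z.
Proof.
intros h hx hy hp; apply (iff2 (mem_prod p h)).
apply BExI with x; [exact hx|ssg]; now apply BExI with y.
Qed.

Lemma prod_uniq G z z' a b a' b' : G ⊢ isProd z a b -> G ⊢ isProd z' a' b' ->
  G ⊢ a ≐ a' -> G ⊢ b ≐ b' -> G ⊢ z ≐ z'.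
Proof.
intros h k ea eb; iext u m.
- ibex (iff1 (mem_prod u h) m) x hx k1; ibex k1 y hy k2.
  apply (@prod_pair _ _ _ _ _ x y k); [apply mem_cong with x a|apply mem_cong with y b|]; eqt.
- ibex (iff1 (mem_prod u k) m) x hx k1; ibex k1 y hy k2.
  apply (@prod_pair _ _ _ _ _ x y h); [apply mem_cong with x a'|apply mem_cong with y b'|]; eqt.
Qed.

Lemma mem_funset G z a b f : G ⊢ isFunSet z a b -> G ⊢ (f ∈ z ≡ isFunction f a b).
Proof. exact (cz_allE f). Qed.

Lemma funset_uniq G z z' a b a' b' : G ⊢ isFunSet z a b -> G ⊢ isFunSet z' a' b' ->
  G ⊢ a ≐ a' -> G ⊢ b ≐ b' -> G ⊢ z ≐ z'.
Proof.
intros h k ea eb; iext u m.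
- apply (iff2 (mem_funset u k)), isFunction_cong with u a b; try eqt.
  exact (iff1 (mem_funset u h) m).
- apply (iff2 (mem_funset u h)), isFunction_cong with u a' b'; try eqt.
  exact (iff1 (mem_funset u k) m).
Qed.

(* Δ0 reformulations of [isUpair], [isPair] and [isFunction], as required by
   the separation axiom. *)
Definition dUpair (u x y : nat) : sfm :=
  x ∈ u ∧ y ∈ u ∧ BAll u (0 ≐ S x ∨ 0 ≐ S y).

Definition dPair (z x y : nat) : sfm :=
  BAll z (dUpair 0 (S x) (S x) ∨ dUpair 0 (S x) (S y)) ∧
  BEx z (dUpair 0 (S x) (S x)) ∧ BEx z (dUpair 0 (S x) (S y)).

Definition dFunction (f a b : nat) : sfm :=
  BAll f (BEx (S a) (BEx (2 + b) (dPair 2 1 0))) ∧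
  BAll a (BEx (S b) (BEx (2 + f) (dPair 0 2 1)) ∧
          BAll (S b) (BAll (2 + b)
            (BEx (3 + f) (dPair 0 3 2) ∧ BEx (3 + f) (dPair 0 3 1) ⊃ 1 ≐ 0))).

Lemma sren_dUpair r u x y : sren r (dUpair u x y) = dUpair (r u) (r x) (r y).
Proof. reflexivity. Qed.
Lemma sren_dPair r u x y : sren r (dPair u x y) = dPair (r u) (r x) (r y).
Proof. reflexivity. Qed.
Lemma sren_dFunction r u x y : sren r (dFunction u x y) = dFunction (r u) (r x) (r y).
Proof. reflexivity. Qed.
#[global] Hint Rewrite sren_dUpair sren_dPair sren_dFunction : sren.

Lemma Delta0_dFunction f a b : Delta0 (dFunction f a b).
Proof.
unfold dFunction, dPair, dUpair.
repeat (apply D0_all || apply D0_ex || apply D0_and || apply D0_or ||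
        apply D0_imp || apply D0_mem || apply D0_eq).
Qed.

Lemma dUpairP G u x y : G ⊢ (isUpair u x y ≡ dUpair u x y).
Proof.
iiff h.
- apply andP; split; [eapply upair_mem1; eassumption|].
  apply andP; split; [eapply upair_mem2; eassumption|].
  iball v m; exact (iff1 (mem_upair v h) m).
- apply andP in h as [h1 h]; apply andP in h as [h2 h].
  iall v; iiff k.
  + ibspec h v as k1; exact k1.
  + ior k e; [apply mem_cong with x u|apply mem_cong with y u]; eqt.
Qed.

Lemma dPairP G z x y : G ⊢ (isPair z x y ≡ dPair z x y).
Proof.
iiff h.
- apply andP; split; [|apply andP; split].
  + iball u m; ior (iff1 (mem_pair u h) m) k; [apply cz_orI1|apply cz_orI2];
      now apply (iff1 (dUpairP _ _ _ _)).
  + iex (upair_ex _ x x) u hu; apply BExI with u.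
    * now apply (iff2 (mem_pair u h)), cz_orI1.
    * now apply (iff1 (dUpairP _ _ _ _)).
  + iex (upair_ex _ x y) u hu; apply BExI with u.
    * now apply (iff2 (mem_pair u h)), cz_orI2.
    * now apply (iff1 (dUpairP _ _ _ _)).
- apply andP in h as [h1 h]; apply andP in h as [h2 h3].
  iall u; iiff k.
  + ibspec h1 u as m; ior m e; [apply cz_orI1|apply cz_orI2];
      now apply (iff2 (dUpairP _ _ _ _)).
  + ior k e.
    * ibex h2 v hv f; apply mem_cong with v z; [|eqt|exact hv].
      eapply upair_uniq; [apply (iff2 (dUpairP _ _ _ _)); eassumption|eassumption].
    * ibex h3 v hv f; apply mem_cong with v z; [|eqt|exact hv].
      eapply upair_uniq; [apply (iff2 (dUpairP _ _ _ _)); eassumption|eassumption].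
Qed.

Lemma dFunctionP G f a b : G ⊢ (isFunction f a b ≡ dFunction f a b).
Proof.
assert (E : forall G x y, G ⊢ BEx f (dPair 0 (S x) (S y)) -> G ⊢ pairIn x y f).
{ intros G' x y h; ibex h p hp k; apply pairIn_intro with p; [|exact hp].
  now apply (iff2 (dPairP _ _ _ _)). }
assert (E' : forall G x y, G ⊢ pairIn x y f -> G ⊢ BEx f (dPair 0 (S x) (S y))).
{ intros G' x y h; ibex h p hp k; apply BExI with p; [exact hp|].
  now apply (iff1 (dPairP _ _ _ _)). }
iiff h.
- apply andP; split.
  + iball p m; ibex (fun_mem h m) x hx e; ibex e y hy hp.
    apply BExI with x; [exact hx|ssg]; apply BExI with y; [exact hy|ssg].
    now apply (iff1 (dPairP _ _ _ _)).
  + iball x m; apply andP; split.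
    * ibex (fun_total h m) y hy k; apply BExI with y; [exact hy|ssg]; now apply E'.
    * iball y hy; iball y' hy'; iimp k; apply andP in k as [k k'].
      eapply fun_uniq; [exact h|apply E, k|apply E, k'].
- pose proof h as [h1 h2]%andP; apply andP; split.
  + iball p m; ibspec h1 p as k; ibex k x hx k1; ibex k1 y hy k2.
    apply BExI with x; [exact hx|ssg]; apply BExI with y; [exact hy|ssg].
    now apply (iff2 (dPairP _ _ _ _)).
  + iball x hx; ibspec h2 x as k; apply andP in k as [k1 k2]; apply andP; split.
    * ibex k1 y hy k; apply BExI with y; [exact hy|ssg]; now apply E.
    (* The Δ0 version states uniqueness only for values in b, the original for all sets. The first
       conjunct closes the gap by placing every second component in b. *)
    * assert (M : forall G y, G ⊢ BAll f (BEx (S a) (BEx (2 + b) (dPair 2 1 0))) ->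
         G ⊢ pairIn x y f -> G ⊢ y ∈ b).
      { intros G' y H e; ibex e p hp e1; ibspec H p as e2; ibex e2 x1 hx1 e3; ibex e3 y1 hy1 e4.
        apply (iff2 (dPairP _ _ _ _)) in e4.
        apply mem_cong with y1 b; [eapply pair_inj2; eassumption|eqt|exact hy1]. }
      iall y; iall y'; iimp k; apply andP in k as [k k'].
      pose proof (M _ _ h1 k) as m; pose proof (M _ _ h1 k') as m'.
      ibspec k2 y as e1; ibspec e1 y' as e2; apply (mp e2); apply andP; split;
        now apply E'.
Qed.

Lemma fun_ext G f g a b a' b' : G ⊢ isFunction f a b -> G ⊢ isFunction g a' b' ->
  G ⊢ All (All (pairIn 1 0 (2 + f) ≡ pairIn 1 0 (2 + g))) -> G ⊢ f ≐ g.
Proof.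
intros hf hg h; iext p m.
- apply (fun_incl hf); [|exact m]; iall x; iall y; iimp k.
  ispec h x as h1; ispec h1 y as h2; exact (iff1 h2 k).
- apply (fun_incl hg); [|exact m]; iall x; iall y; iimp k.
  ispec h x as h1; ispec h1 y as h2; exact (iff2 h2 k).
Qed.

(* Subset collection is applied to [a] and [a × b], for the relation between [x]
   and the pairs (x, y) in [u]: the subset it provides for a function [u] is [u]. *)
Lemma funset_ex G a b : G ⊢ Ex (isFunSet 0 (S a) (S b)).
Proof.
iex (prod_ex _ a b) P hP.
pose proof (cz_ax G (czf_subset_coll (0 ∈ 2 ∧ Ex (isPair 1 2 0)))) as e.
ispec e a as e1; ispec e1 P as e2; clear e e1; iex e2 c hc.
pose proof (cz_ax G (czf_sep (Delta0_dFunction 0 (2 + a) (2 + b)))) as e.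
ispec e c as e1; clear e; iex e1 z hz; clear e1 e2.
use z; iall f; ispec hz f as k; ispec hc f as kc; clear hz hc.
iiff h.
- apply (iff2 (dFunctionP _ _ _ _)), (cz_andE2 (iff1 k h)).
- apply (iff2 k); apply andP; split; [|now apply (iff1 (dFunctionP _ _ _ _))].
  assert (A : G ⊢ BAll a (BEx (S P) (0 ∈ 2 + f ∧ Ex (isPair 1 2 0)))).
  { iball x hx; ibex (fun_total h hx) y hy e; ibex e p hp e1.
    apply BExI with p; [eapply prod_pair; eassumption|ssg].
    apply andP; split; [exact hp|use y; exact e1]. }
  pose proof (mp kc A) as D; ibex D d hd D1; apply andP in D1 as [D1 D2].
  (* Members of d are in f by the chosen relation. Conversely, d has a pair with first component x
     that lies in f, and as f is single-valued this is the pair of f at x. *)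
  apply mem_cong with d c; [|eqt|exact hd]; iext q m.
  + ibspec D2 q as e; ibex e x hx e1; exact (cz_andE1 e1).
  + ibex (fun_mem h m) x hx e; ibex e y hy hq.
    ibspec D1 x as e1; ibex e1 p hp e2; apply andP in e2 as [e2 e3].
    iex e3 y' hp'; apply mem_cong with p d; [|eqt|exact hp].
    assert (G ⊢ y' ≐ y) by (eapply fun_uniq; [exact h|eapply pairIn_intro; eassumption..]).
    eapply pair_uniq; [|exact hq]; apply isPair_cong with p x y'; eqt.
Qed.

(** * Primitive recursion on ω *)

(* Every (n, x) ∈ h has x ∈ A and is justified by the recursion equations from
   pairs in h: either n = 0 and x = b, or n = m + 1 and x = f(y)(m) for some
   (m, y) ∈ h. *)
Definition Justified (h w A b f : nat) : sfm :=
  All (All (pairIn 1 0 (2 + h) ⊃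
    0 ∈ 2 + A ∧
    (isEmpty 1 ∧ 0 ≐ 2 + b ∨
     Ex (Ex (Ex (2 ∈ 5 + w ∧ isSucc 4 2 ∧ pairIn 2 1 (5 + h) ∧
                 pairIn 1 0 (5 + f) ∧ pairIn 2 3 0)))))).

(* h(n) = x for the recursively defined function h *)
Definition RecGraph (x n w A b f : nat) : sfm :=
  Ex (pairIn (S n) (S x) 0 ∧ Justified 0 (S w) (S A) (S b) (S f)).

Lemma sren_Justified r h w A b f :
  sren r (Justified h w A b f) = Justified (r h) (r w) (r A) (r b) (r f).
Proof. reflexivity. Qed.
Lemma sren_RecGraph r x n w A b f :
  sren r (RecGraph x n w A b f) = RecGraph (r x) (r n) (r w) (r A) (r b) (r f).
Proof. reflexivity. Qed.
#[global] Hint Rewrite sren_Justified sren_RecGraph : sren.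

Lemma recgraph_zero G n w A b f :
  G ⊢ isEmpty n -> G ⊢ b ∈ A -> G ⊢ RecGraph b n w A b f.
Proof.
(* The witness is h = {(n, b)}. *)
intros hn hb; iex (pair_ex _ n b) p hp; iex (upair_ex _ p p) h hh.
use h; apply andP; split.
- apply pairIn_intro with p; [exact hp|eapply upair_mem1; eassumption].
- iall n'; iall x; iimp k; ibex k q hq e.
  pose proof (sing_mem hh hq) as e1.
  assert (e2 : G ⊢ isPair p n' x) by (apply isPair_cong with q n' x; eqt).
  pose proof (pair_inj1 hp e2); pose proof (pair_inj2 hp e2).
  apply andP; split; [apply mem_cong with b A; eqt|].
  apply cz_orI1, andP; split; [apply isEmpty_cong with n; eqt|eqt].
Qed.

(** The witness is h ∪ {(m, y)}. Old pairs stay justified, because a justification only asks for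
    pairs of h that are still present ([I]), and the new pair is justified by (n, x). *)
Lemma recgraph_succ G n m x y g w A b f : G ⊢ RecGraph x n w A b f ->
  G ⊢ n ∈ w -> G ⊢ isSucc m n -> G ⊢ pairIn x g f -> G ⊢ pairIn n y g -> G ⊢ y ∈ A ->
  G ⊢ RecGraph y m w A b f.
Proof.
intros h0 hn hm hg hy ha; iex h0 h e; apply andP in e as [e1 e2].
iex (pair_ex _ m y) p hp; iex (adjoin_ex _ h p) h' hh.
assert (I : G ⊢ All (All (pairIn 1 0 (2 + h) ⊃ pairIn 1 0 (2 + h')))).
{ iall a; iall c; iimp k; ibex k q hq k1; apply pairIn_intro with q; [exact k1|].
  ispec hh q as k2; apply (iff2 k2); now apply cz_orI1. }
use h'; apply andP; split.
- apply pairIn_intro with p; [exact hp|].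
  ispec hh p as k; apply (iff2 k), cz_orI2, cz_refl.
- iall n'; iall x'; iimp k; ibex k q hq k1; ispec hh q as k2.
  ior (iff1 k2 hq) k3.
  + ispec e2 n' as e3; ispec e3 x' as e4.
    pose proof (mp e4 (pairIn_intro k1 k3)) as e5; apply andP in e5 as [e5 e6].
    apply andP; split; [exact e5|]; ior e6 e7; [now apply cz_orI1|].
    iex e7 m1 e8; iex e8 y1 e9; iex e9 g1 e10.
    apply andP in e10 as [f1 e10]; apply andP in e10 as [f2 e10];
      apply andP in e10 as [f3 e10].
    apply cz_orI2; use m1; use y1; use g1.
    apply andP; split; [exact f1|]; apply andP; split; [exact f2|].
    apply andP; split; [|exact e10].
    ispec I m1 as I1; ispec I1 y1 as I2; exact (mp I2 f3).
  + assert (e4 : G ⊢ isPair p n' x') by (apply isPair_cong with q n' x'; eqt).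
    pose proof (pair_inj1 hp e4); pose proof (pair_inj2 hp e4).
    apply andP; split; [apply mem_cong with y A; eqt|].
    apply cz_orI2; use n; use x; use g.
    apply andP; split; [exact hn|].
    apply andP; split; [apply isSucc_cong with m n; eqt|].
    apply andP; split; [ispec I n as I1; ispec I1 x as I2; exact (mp I2 e1)|].
    apply andP; split; [exact hg|apply pairIn_cong with n y g; eqt].
Qed.

Section Recursion.

Context (w A b f F : nat).

(** F is the set of functions from w to A: f sends a value x to the function that maps n to the next
    value. *)
Let rec_data G := (G ⊢ isOmega w) /\ (G ⊢ b ∈ A) /\ (G ⊢ isFunction f A F) /\
  (G ⊢ isFunSet F w A).

Lemma step_ex G n x : rec_data G -> G ⊢ n ∈ w -> G ⊢ x ∈ A ->
  G ⊢ Ex (BEx (S A) (pairIn (2 + x) 1 (2 + f) ∧ pairIn (2 + n) 0 1)).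
Proof.
intros (hw & hb & hf & hF) hn hx; ibex (fun_total hf hx) g hg k.
ibex (fun_total (iff1 (mem_funset g hF) hg) hn) y hy k1.
use g; apply BExI with y; [exact hy|ssg]; now apply andP.
Qed.

Lemma step_uniq G n x x' g g' y y' : rec_data G -> G ⊢ x ≐ x' ->
  G ⊢ pairIn x g f -> G ⊢ pairIn n y g -> G ⊢ pairIn x' g' f -> G ⊢ pairIn n y' g' ->
  G ⊢ y ≐ y'.
Proof.
intros (hw & hb & hf & hF) e h1 h2 h3 h4.
destruct (fun_dom hf h1) as [_ hg].
assert (G ⊢ g ≐ g').
{ apply (fun_uniq hf h1), pairIn_cong with x' g' f; eqt. }
apply (fun_uniq (iff1 (mem_funset g hF) hg) h2), pairIn_cong with n y' g'; eqt.
Qed.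

Lemma rec_data_weaken G G' : incl G G' -> rec_data G -> rec_data G'.
Proof. intros i (hw & hb & hf & hF); repeat split; eauto using CZF_weaken. Qed.

Lemma recgraph_total G n : rec_data G -> G ⊢ n ∈ w ->
  G ⊢ BEx A (RecGraph 0 (S n) (S w) (S A) (S b) (S f)).
Proof.
intros (hw & hb & hf & hF) hn.
apply (@omega_ind G (BEx (S A) (RecGraph 0 1 (2 + w) (2 + A) (2 + b) (2 + f))) w hw);
  [..|exact hn]; intros G' i; weaken_hyps i.
- intros u hu; ssg; apply BExI with b; [exact hb|ssg]; now apply recgraph_zero.
- intros u v hv hu k; ssin k; ssg; ibex k x hx k1.
  assert (R : rec_data G) by now repeat split.
  iex (step_ex R hv hx) g e; ibex e y hy e1; apply andP in e1 as [e1 e2].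
  apply BExI with y; [exact hy|ssg].
  exact (recgraph_succ k1 hv hu e1 e2 hy).
Qed.

(** Induction on n, by inverting justifications. At zero only the first clause can apply. At a
    successor only the second can, its predecessor is v by [succ_inj], and the same h witnesses the
    value at v, so the induction hypothesis applies. *)
Lemma recgraph_uniq G n x x' : rec_data G -> G ⊢ n ∈ w ->
  G ⊢ RecGraph x n w A b f -> G ⊢ RecGraph x' n w A b f -> G ⊢ x ≐ x'.
Proof.
intros (hw & hb & hf & hF) hn hx hx'.
assert (H : G ⊢ sinst (All (All (RecGraph 1 2 (3 + w) (3 + A) (3 + b) (3 + f)
    ∧ RecGraph 0 2 (3 + w) (3 + A) (3 + b) (3 + f) ⊃ 1 ≐ 0))) n).
{ clear hx hx'; apply omega_ind with w; [exact hw|..|exact hn]; intros G' i; weaken_hyps i.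
  - intros u hu; ssg; iall x1; iall x2; iimp k; apply andP in k as [k1 k2].
    assert (E : forall x, G ⊢ (RecGraph x u w A b f ⊃ x ≐ b)).
    { intro x3; iimp k; iex k h k3; apply andP in k3 as [k3 k4].
      ispec k4 u as k5; ispec k5 x3 as k6; pose proof (cz_andE2 (mp k6 k3)) as k7.
      ior k7 k8; [exact (cz_andE2 k8)|].
      iex k8 m e1; iex e1 y e2; iex e2 g e3; apply andP in e3 as [_ e3].
      apply cz_andE1 in e3; exact (empty_ex_false _ hu (succ_mem e3)). }
    pose proof (mp (E x1) k1); pose proof (mp (E x2) k2); eqt.
  - intros u v hv hu IH; ssin IH; ssg; iall x1; iall x2; iimp k; apply andP in k as [k1 k2].
    assert (E : forall x, G ⊢ (RecGraph x u w A b f ⊃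
       Ex (Ex (RecGraph 1 (2 + v) (2 + w) (2 + A) (2 + b) (2 + f) ∧
         pairIn 1 0 (2 + f) ∧ pairIn (2 + v) (2 + x) 0)))).
    { intro x3; iimp k; iex k h k3; apply andP in k3 as [k3 k4].
      ispec k4 u as k5; ispec k5 x3 as k6; pose proof (cz_andE2 (mp k6 k3)) as k7.
      ior k7 k8; [apply cz_andE1 in k8; exact (empty_ex_false _ k8 (succ_mem hu))|].
      iex k8 m e1; iex e1 y e2; iex e2 g e3.
      apply andP in e3 as [f1 e3]; apply andP in e3 as [f2 e3];
        apply andP in e3 as [f3 e3]; apply andP in e3 as [f4 f5].
      pose proof (succ_inj f2 hu).
      use y; use g; apply andP; split; [|apply andP; split].
      - use h; apply andP; split; [apply pairIn_cong with m y h; eqt|exact k4].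
      - exact f4.
      - apply pairIn_cong with m x3 g; eqt. }
    iex (mp (E x1) k1) y1 e1; iex e1 g1 e2.
    iex (mp (E x2) k2) y2 e3; iex e3 g2 e4; clear E.
    apply andP in e2 as [e2 e5]; apply andP in e5 as [e5 e6].
    apply andP in e4 as [e4 e7]; apply andP in e7 as [e7 e8].
    ispec IH y1 as IH1; ispec IH1 y2 as IH2.
    assert (e9 : G ⊢ y1 ≐ y2) by (apply (mp IH2); now apply andP).
    assert (R : rec_data G) by now repeat split.
    exact (step_uniq R e9 e5 e6 e7 e8). }
ssin H; ispec H x as H1; ispec H1 x' as H2; apply (mp H2); now apply andP.
Qed.

(** z : w → A satisfies the recursion equations given by b and f. *)
Definition isRec (z w A b f : nat) : sfm :=
  isFunction z w A ∧
  All (isEmpty 0 ⊃ pairIn 0 (S b) (S z)) ∧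
  BAll w (All (All (All (All (
    isSucc 3 4 ∧ pairIn 4 2 (5 + z) ∧ pairIn 2 1 (5 + f) ∧ pairIn 4 0 1 ⊃
    pairIn 3 0 (5 + z)))))).

Lemma sren_isRec r z w' A' b' f' :
  sren r (isRec z w' A' b' f') = isRec (r z) (r w') (r A') (r b') (r f').
Proof. reflexivity. Qed.

Lemma rec_zero G z n : G ⊢ isRec z w A b f -> G ⊢ isEmpty n -> G ⊢ pairIn n b z.
Proof. intros [_ [h _]%andP]%andP k; ispec h n as h1; exact (mp h1 k). Qed.

Lemma rec_succ G z n m x g y : G ⊢ isRec z w A b f -> G ⊢ n ∈ w -> G ⊢ isSucc m n ->
  G ⊢ pairIn n x z -> G ⊢ pairIn x g f -> G ⊢ pairIn n y g -> G ⊢ pairIn m y z.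
Proof.
intros [_ [_ h]%andP]%andP k k1 k2 k3 k4; ibspec h n as h1.
ispec h1 m as h2; ispec h2 x as h3; ispec h3 g as h4; ispec h4 y as h5.
apply (mp h5); repeat (apply andP; split); assumption.
Qed.

Lemma rec_ex G : rec_data G -> G ⊢ Ex (isRec 0 (S w) (S A) (S b) (S f)).
Proof.
intro R; pose proof R as (hw & hb & hf & hF).
set (B := RecGraph 0 1 (2 + w) (2 + A) (2 + b) (2 + f)).
assert (U : forall G', incl G G' -> forall n x x', G' ⊢ n ∈ w ->
   G' ⊢ inst2 B x n -> G' ⊢ inst2 B x' n -> G' ⊢ x ≐ x').
{ intros G' i n x x' hn; apply recgraph_uniq; eauto using rec_data_weaken. }
assert (T : G ⊢ BAll w (BEx (S A) B)).
{ clear U R; iball n hn; apply recgraph_total; [now repeat split|exact hn]. }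
assert (E : G ⊢ Ex (isGraph 0 (S w) (sren (upr (upr S)) B))).
{ apply graph_ex; [|exact U]; clear U R; iball n hn; ibspec T n as k.
  ibex k x hx k1; use x; exact k1. }
apply (exE E); intros G1 i1 z hz; ssin hz.
assert (U' : forall G', incl G1 G' -> forall n x x', G' ⊢ n ∈ w ->
   G' ⊢ inst2 B x n -> G' ⊢ inst2 B x' n -> G' ⊢ x ≐ x').
{ intros G' i; apply U; incls. }
clear U E R; weaken_hyps i1.
pose proof (graph_function hz T U') as hzf; clear U'.
use z; apply andP; split; [exact hzf|apply andP; split].
- iall u; iimp hu; apply (graph_pairI hz); [now apply omega_zero|].
  now apply recgraph_zero.
- iball n hn; iall m; iall x; iall g; iall y; iimp k.
  apply andP in k as [k1 k]; apply andP in k as [k2 k]; apply andP in k as [k3 k4].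
  apply (graph_pairI hz); [now apply omega_succ with n|].
  apply (graph_pairE hz) in k2 as [_ k2].
  destruct (fun_dom hf k3) as [_ hg].
  destruct (fun_dom (iff1 (mem_funset g hF) hg) k4) as [_ hy].
  exact (recgraph_succ k2 hn k1 k3 k4 hy).
Qed.

(** Induction on n proves one inclusion between graphs: at a successor both functions make the same
    step from a value at v that they share. Exchanging z and z' then yields equality. *)
Lemma rec_incl G z z' : rec_data G -> G ⊢ isRec z w A b f -> G ⊢ isRec z' w A b f ->
  G ⊢ All (All (pairIn 1 0 (2 + z) ⊃ pairIn 1 0 (2 + z'))).
Proof.
intros (hw & hb & hf & hF) h h'.
pose proof (cz_andE1 h) as hz; pose proof (cz_andE1 h') as hz'.
iall n; iall x; iimp k; destruct (fun_dom hz k) as [hn _].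
assert (H : G ⊢ sinst (All (pairIn 1 0 (2 + z) ⊃ pairIn 1 0 (2 + z'))) n).
{ clear k; apply omega_ind with w; [exact hw|..|exact hn]; intros G' i; weaken_hyps i.
  - intros u hu; ssg; iall y; iimp k.
    pose proof (rec_zero h hu) as k1; pose proof (fun_uniq hz k k1).
    apply pairIn_cong with u b z'; [eqt|eqt|eqt|exact (rec_zero h' hu)].
  - intros u v hv hu IH; ssin IH; ssg; iall y; iimp k.
    ibex (fun_total hz hv) x1 hx1 k1.
    assert (R : rec_data G) by now repeat split.
    iex (step_ex R hv hx1) g e; ibex e y1 hy1 e1; apply andP in e1 as [e1 e2].
    pose proof (rec_succ h hv hu k1 e1 e2) as e3.
    pose proof (fun_uniq hz k e3).
    apply pairIn_cong with u y1 z'; [eqt|eqt|eqt|].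
    apply (rec_succ (x := x1) (g := g) h' hv hu); [|exact e1|exact e2].
    ispec IH x1 as IH1; exact (mp IH1 k1). }
ssin H; ispec H x as H1; exact (mp H1 k).
Qed.

Lemma rec_uniq G z z' : rec_data G -> G ⊢ isRec z w A b f -> G ⊢ isRec z' w A b f ->
  G ⊢ z ≐ z'.
Proof.
intros R h h'; apply (fun_ext (cz_andE1 h) (cz_andE1 h')).
pose proof (rec_incl R h h') as k; pose proof (rec_incl R h' h) as k'; clear R.
iall x; iall y; ispec k x as k1; ispec k1 y as k2; ispec k' x as k3; ispec k3 y as k4.
now apply andP.
Qed.

End Recursion.
#[global] Hint Rewrite sren_isRec : sren.

(** * Definable terms *)

(** The free indices of t satisfy P. With P empty this says that t is closed, so that its value does
    not depend on the valuation; types and constants are of this kind. *)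
Fixpoint fvs (P : nat -> Prop) (t : dtm) : Prop :=
  match t with
  | DVar i => P i
  | DEmpty | DOmega => True
  | DSucc t | DFst t | DSnd t => fvs P t
  | DPair t u | DProd t u | DFunSet t u | DApp t u => fvs P t /\ fvs P u
  | DLam a b => fvs P a /\ fvs (fun i => match i with 0 => True | S j => P j end) b
  | DRec a b f => fvs P a /\ fvs P b /\ fvs P f
  end.

Lemma den_ext t : forall P r r' z, fvs P t -> (forall i, P i -> r i = r' i) ->
  den r t z = den r' t z.
Proof.
induction t; intros P r r' z F E; cbn in *;
  repeat match goal with h : _ /\ _ |- _ => destruct h end.
- now rewrite (E n).
- reflexivity.
- reflexivity.
- erewrite IHt; [reflexivity|eassumption|]; cbn; auto.
- erewrite IHt1, IHt2; [reflexivity|eassumption| |eassumption|]; cbn; auto.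
- erewrite IHt; [reflexivity|eassumption|]; cbn; auto.
- erewrite IHt; [reflexivity|eassumption|]; cbn; auto.
- erewrite IHt1, IHt2; [reflexivity|eassumption| |eassumption|]; cbn; auto.
- erewrite IHt1, IHt2; [reflexivity|eassumption| |eassumption|]; cbn; auto.
- erewrite IHt1, IHt2; [reflexivity|eassumption| |eassumption|]; cbn; auto.
- erewrite IHt1, IHt2; [reflexivity|eassumption| |eassumption|]; cbn; auto.
  intros [|i] H1; cbn; auto 6.
- erewrite IHt1, IHt2, IHt3;
    [reflexivity|eassumption| |eassumption| |eassumption|]; cbn; auto 6.
Qed.

Lemma fvs_True (P : nat -> Prop) t : (forall i, P i) -> fvs P t.
Proof.
revert P; induction t; intros P h; cbn; auto.
split; auto; apply IHt2; intros [|i]; auto.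
Qed.

Lemma den_ext_all t r r' z : (forall i, r i = r' i) -> den r t z = den r' t z.
Proof. intro e; apply den_ext with (fun i => r i = r' i); auto; now apply fvs_True. Qed.

Lemma sren_den t : forall r r' z,
  sren r' (den r t z) = den (fun i => r' (r i)) t (r' z).
Proof.
induction t; intros r r' z;
  try (cbn; rewrite ?IHt, ?IHt1, ?IHt2, ?IHt3; reflexivity).
cbn -[BEx]; rewrite IHt1, sren_BEx; cbn; rewrite IHt2; cbn.
rewrite (@den_ext_all t2 _ (ncons 1 (fun i => 4 + r' (r i)))); [reflexivity|now intros [|i]].
Qed.
#[global] Hint Rewrite sren_den : sren.

Lemma den_cong G t r r' z z' : (forall i, G ⊢ r i ≐ r' i) -> G ⊢ z ≐ z' ->
  G ⊢ den r t z -> G ⊢ den r' t z'.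
Proof.
intros E e h.
(* All denotation formulas of t are renamings of the single formula [den S t 0], where index 0 is
   reserved for the value; hence [sren_cong] applies. *)
assert (D : forall r z, den r t z = sren (ncons z r) (den S t 0)).
{ intros; now rewrite sren_den. }
rewrite D in *; revert h; apply sren_cong; intros [|i]; cbn; auto.
Qed.

(** * The sets interpreting the types *)

Definition tyset (s : ty) (z : nat) : sfm := den ids (ty_tr s) z.
Definition inT (s : ty) (x : nat) : sfm := in_dtm x (ty_tr s).

Lemma fvs_ty P s : fvs P (ty_tr s).
Proof. induction s; cbn; auto. Qed.

Lemma den_ty r s z : den r (ty_tr s) z = tyset s z.
Proof. apply den_ext with (fun _ => False); [apply fvs_ty|tauto]. Qed.

Lemma sren_tyset r s z : sren r (tyset s z) = tyset s (r z).
Proof. unfold tyset at 1; now rewrite sren_den, den_ty. Qed.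

Lemma inT_def s x : inT s x = Ex (tyset s 0 ∧ S x ∈ 0).
Proof. unfold inT, in_dtm; now rewrite den_ty. Qed.

Lemma sren_inT r s x : sren r (inT s x) = inT s (r x).
Proof. rewrite !inT_def; cbn; now rewrite sren_tyset. Qed.
#[global] Hint Rewrite sren_tyset sren_inT : sren.

Lemma tyset_arr s t z :
  tyset (s ⇒ t) z = Ex (Ex (tyset s 1 ∧ tyset t 0 ∧ isFunSet (2 + z) 1 0)).
Proof. unfold tyset at 1; cbn [ty_tr den]; now rewrite !den_ty. Qed.

Lemma tyset_prod s t z :
  tyset (s ⊗ t) z = Ex (Ex (tyset s 1 ∧ tyset t 0 ∧ isProd (2 + z) 1 0)).
Proof. unfold tyset at 1; cbn [ty_tr den]; now rewrite !den_ty. Qed.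

Lemma tyset_ex s : forall G, G ⊢ Ex (tyset s 0).
Proof.
induction s; intro G.
- apply omega_ex.
- iex (IHs1 _) a ha; iex (IHs2 _) b hb; iex (funset_ex _ a b) z hz.
  use z; rewrite tyset_arr; use a; use b; repeat (apply andP; split); assumption.
- iex (IHs1 _) a ha; iex (IHs2 _) b hb; iex (prod_ex _ a b) z hz.
  use z; rewrite tyset_prod; use a; use b; repeat (apply andP; split); assumption.
Qed.

Lemma tyset_uniq s : forall G z z', G ⊢ tyset s z -> G ⊢ tyset s z' -> G ⊢ z ≐ z'.
Proof.
induction s; intros G z z' h h'.
- exact (omega_uniq h h').
- rewrite tyset_arr in h, h'.
  iex h a e; iex e b e1; iex h' a' e2; iex e2 b' e3.
  apply andP in e1 as [k1 e1]; apply andP in e1 as [k2 k3].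
  apply andP in e3 as [k4 e3]; apply andP in e3 as [k5 k6].
  eapply funset_uniq; [exact k3|exact k6|eauto..].
- rewrite tyset_prod in h, h'.
  iex h a e; iex e b e1; iex h' a' e2; iex e2 b' e3.
  apply andP in e1 as [k1 e1]; apply andP in e1 as [k2 k3].
  apply andP in e3 as [k4 e3]; apply andP in e3 as [k5 k6].
  eapply prod_uniq; [exact k3|exact k6|eauto..].
Qed.

Lemma inT_I G s T x : G ⊢ tyset s T -> G ⊢ x ∈ T -> G ⊢ inT s x.
Proof. intros h k; rewrite inT_def; use T; now apply andP. Qed.

Lemma inT_E G s T x : G ⊢ tyset s T -> G ⊢ inT s x -> G ⊢ x ∈ T.
Proof.
intros h k; rewrite inT_def in k; iex k T' e; apply andP in e as [e1 e2].
apply mem_cong with x T'; [eqt|exact (tyset_uniq e1 h)|exact e2].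
Qed.

Lemma inT_cong G s x x' : G ⊢ x ≐ x' -> G ⊢ inT s x -> G ⊢ inT s x'.
Proof.
intros e h; iex (tyset_ex s _) T hT; apply (inT_I hT).
apply mem_cong with x T; [eqt|eqt|exact (inT_E hT h)].
Qed.

(** The sets hidden in [tyset (s ⇒ t)] need not be a and b. But the function set from a to b
    interprets s ⇒ t as well, and so equals z by [tyset_uniq]. *)
Lemma tyset_arr_funset G s t a b : G ⊢ tyset s a -> G ⊢ tyset t b ->
  forall z, G ⊢ tyset (s ⇒ t) z -> G ⊢ isFunSet z a b.
Proof.
intros ha hb z h; iex (funset_ex _ a b) z' hz'.
assert (k : G ⊢ tyset (s ⇒ t) z').
{ rewrite tyset_arr; use a; use b; repeat (apply andP; split); assumption. }
apply allI; intro f; ssg; pose proof (tyset_uniq h k); iiff e.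
- apply (iff1 (mem_funset f hz')), mem_cong with f z; eqt.
- apply mem_cong with f z'; [eqt|eqt|exact (iff2 (mem_funset f hz') e)].
Qed.

Lemma inT_fun G s t a b f : G ⊢ tyset s a -> G ⊢ tyset t b ->
  G ⊢ isFunction f a b -> G ⊢ inT (s ⇒ t) f.
Proof.
intros ha hb h; iex (tyset_ex (s ⇒ t) _) z hz; apply (inT_I hz).
exact (iff2 (mem_funset f (tyset_arr_funset ha hb hz)) h).
Qed.

Lemma inT_fun_inv G s t a b f : G ⊢ tyset s a -> G ⊢ tyset t b ->
  G ⊢ inT (s ⇒ t) f -> G ⊢ isFunction f a b.
Proof.
intros ha hb h; iex (tyset_ex (s ⇒ t) _) z hz.
exact (iff1 (mem_funset f (tyset_arr_funset ha hb hz)) (inT_E hz h)).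
Qed.

Lemma app_total G s t f x : G ⊢ inT (s ⇒ t) f -> G ⊢ inT s x ->
  G ⊢ Ex (inT t 0 ∧ pairIn (S x) 0 (S f)).
Proof.
intros h k; iex (tyset_ex s _) a ha; iex (tyset_ex t _) b hb.
ibex (fun_total (inT_fun_inv ha hb h) (inT_E ha k)) y hy e.
use y; apply andP; split; [exact (inT_I hb hy)|exact e].
Qed.

Lemma app_uniq G s t f x y y' : G ⊢ inT (s ⇒ t) f ->
  G ⊢ pairIn x y f -> G ⊢ pairIn x y' f -> G ⊢ y ≐ y'.
Proof.
intros h k k'; iex (tyset_ex s _) a ha; iex (tyset_ex t _) b hb.
exact (fun_uniq (inT_fun_inv ha hb h) k k').
Qed.

Lemma inT_pair G s t p x y : G ⊢ inT s x -> G ⊢ inT t y -> G ⊢ isPair p x y ->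
  G ⊢ inT (s ⊗ t) p.
Proof.
intros hx hy hp; iex (tyset_ex s _) a ha; iex (tyset_ex t _) b hb.
iex (prod_ex _ a b) z hz; apply inT_I with z.
- rewrite tyset_prod; use a; use b; repeat (apply andP; split); assumption.
- exact (prod_pair hz (inT_E ha hx) (inT_E hb hy) hp).
Qed.

Lemma inT_prodE G s t p : G ⊢ inT (s ⊗ t) p ->
  G ⊢ Ex (Ex (inT s 1 ∧ inT t 0 ∧ isPair (2 + p) 1 0)).
Proof.
intro h; iex (tyset_ex (s ⊗ t) _) z hz.
pose proof (inT_E hz h) as m; rewrite tyset_prod in hz; iex hz a e; iex e b e1.
apply andP in e1 as [k1 e1]; apply andP in e1 as [k2 k3].
ibex (iff1 (mem_prod p k3) m) x hx e2; ibex e2 y hy e3.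
use x; use y; repeat (apply andP; split); eauto using inT_I.
Qed.

(** * Well-typed definable terms denote *)

(** Uniqueness is asked at every larger list, since a Coq implication between derivations from G
    alone would not survive weakening. *)
Definition good (G : list sfm) (r : nat -> nat) (t : dtm) (s : ty) : Prop :=
  (G ⊢ Ex (inT s 0 ∧ den (fun i => S (r i)) t 0)) /\
  (forall G', incl G G' -> forall y y', G' ⊢ den r t y -> G' ⊢ den r t y' -> G' ⊢ y ≐ y').

Lemma good_weaken G G' r t s : incl G G' -> good G r t s -> good G' r t s.
Proof.
intros i [h k]; split; [exact (CZF_weaken i h)|].
intros G2 j; apply k; eauto using incl_tran.
Qed.

Ltac weaken_hook i ::=
  match goal with h : good _ _ _ _ |- _ => apply (good_weaken i) in h end.

Lemma good_ex G r t s : good G r t s -> G ⊢ Ex (inT s 0 ∧ den (fun i => S (r i)) t 0).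
Proof. now intros []. Qed.

Lemma good_uniq G r t s y y' : good G r t s ->
  G ⊢ den r t y -> G ⊢ den r t y' -> G ⊢ y ≐ y'.
Proof. intros [_ k]; apply k, incl_refl. Qed.

Lemma good_inT G r t s y : good G r t s -> G ⊢ den r t y -> G ⊢ inT s y.
Proof.
intros g h; iex (good_ex g) y' e; apply andP in e as [e1 e2].
apply inT_cong with y'; [exact (good_uniq g e2 h)|exact e1].
Qed.

Tactic Notation "igood" constr(g) ident(y) ident(hy) ident(e) :=
  let k := fresh in iex (good_ex g) y k; apply andP in k as [hy e].

Lemma den_eq G r t z z' : G ⊢ z ≐ z' -> G ⊢ den r t z -> G ⊢ den r t z'.
Proof. apply den_cong; intro; apply cz_refl. Qed.

Lemma good_var G r i s : G ⊢ inT s (r i) -> good G r (DVar i) s.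
Proof.
intro h; split.
- use (r i); apply andP; split; [exact h|apply cz_refl].
- intros G' _ y y' e e'; cbn in e, e'; eqt.
Qed.

Lemma inT_zero G z : G ⊢ isEmpty z -> G ⊢ inT N z.
Proof. intro h; iex (omega_ex _) w hw; exact (inT_I (s := N) hw (omega_zero hw h)). Qed.

Lemma inT_succ G n m : G ⊢ inT N n -> G ⊢ isSucc m n -> G ⊢ inT N m.
Proof.
intros h k; iex (omega_ex _) w hw.
exact (inT_I (s := N) hw (omega_succ hw (inT_E (s := N) hw h) k)).
Qed.

Lemma good_empty G r : good G r DEmpty N.
Proof.
split.
- iex (empty_ex _) z hz; use z; apply andP; split; [now apply inT_zero|exact hz].
- intros G' _ y y' e e'; exact (empty_uniq e e').
Qed.

Lemma good_succ G r t : good G r t N -> good G r (DSucc t) N.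
Proof.
intro g; split.
- igood g n hn e; iex (succ_ex _ n) m hm; use m; apply andP; split.
  + exact (inT_succ hn hm).
  + use n; now apply andP.
- intros G' i y y' h h'; apply (good_weaken i) in g; clear i; cbn [den] in h, h'.
  iex h n e; iex h' n' e'; apply andP in e as [e1 e2], e' as [e1' e2'].
  pose proof (good_uniq g e1 e1').
  apply (succ_uniq e2), isSucc_cong with y' n'; eqt.
Qed.

Lemma good_pair G r t u s s' : good G r t s -> good G r u s' ->
  good G r (DPair t u) (s ⊗ s').
Proof.
intros g g'; split.
- igood g x hx e; igood g' y hy e'; iex (pair_ex _ x y) p hp; use p.
  apply andP; split; [exact (inT_pair hx hy hp)|].
  use x; use y; repeat (apply andP; split); assumption.
- intros G' i p p' h h'; apply (good_weaken i) in g, g'; clear i; cbn [den] in h, h'.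
  iex h x k; iex k y k1; iex h' x' k2; iex k2 y' k3.
  apply andP in k1 as [e1 k1]; apply andP in k1 as [e2 e3].
  apply andP in k3 as [e4 k3]; apply andP in k3 as [e5 e6].
  pose proof (good_uniq g e1 e4); pose proof (good_uniq g' e2 e5).
  apply (pair_uniq e3), isPair_cong with p' x' y'; eqt.
Qed.

Lemma good_fst G r t s s' : good G r t (s ⊗ s') -> good G r (DFst t) s.
Proof.
intros g; split.
- igood g p hp e; iex (inT_prodE hp) x k; iex k y k1.
  apply andP in k1 as [e1 k1]; apply andP in k1 as [e2 e3].
  use x; apply andP; split; [exact e1|]; use p; use y; now apply andP.
- intros G' i x x' h h'; apply (good_weaken i) in g; clear i; cbn [den] in h, h'.
  iex h p k; iex k y k1; iex h' p' k2; iex k2 y' k3.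
  apply andP in k1 as [e1 k1], k3 as [e2 k3].
  pose proof (good_uniq g e1 e2).
  apply (pair_inj1 k1 (y' := y')), isPair_cong with p' x' y'; eqt.
Qed.

Lemma good_snd G r t s s' : good G r t (s ⊗ s') -> good G r (DSnd t) s'.
Proof.
intros g; split.
- igood g p hp e; iex (inT_prodE hp) x k; iex k y k1.
  apply andP in k1 as [e1 k1]; apply andP in k1 as [e2 e3].
  use y; apply andP; split; [exact e2|]; use p; use x; now apply andP.
- intros G' i x x' h h'; apply (good_weaken i) in g; clear i; cbn [den] in h, h'.
  iex h p k; iex k y k1; iex h' p' k2; iex k2 y' k3.
  apply andP in k1 as [e1 k1], k3 as [e2 k3].
  pose proof (good_uniq g e1 e2).
  apply (pair_inj2 k1 (x' := y')), isPair_cong with p' y' x'; eqt.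
Qed.

Lemma den_app G r f t u v z : G ⊢ den r f u -> G ⊢ den r t v -> G ⊢ pairIn v z u ->
  G ⊢ den r (DApp f t) z.
Proof. intros h k e; use u; use v; repeat (apply andP; split); assumption. Qed.

Lemma good_app G r f t s s' : good G r f (s ⇒ s') -> good G r t s ->
  good G r (DApp f t) s'.
Proof.
intros g g'; split.
- igood g u hu e; igood g' v hv e'; iex (app_total hu hv) z k.
  apply andP in k as [k1 k2]; use z; apply andP; split; [exact k1|].
  exact (den_app e e' k2).
- intros G' i y y' h h'; apply (good_weaken i) in g, g'; clear i; cbn [den] in h, h'.
  iex h u k; iex k v k1; iex h' u' k2; iex k2 v' k3.
  apply andP in k1 as [e1 k1]; apply andP in k1 as [e2 e3].
  apply andP in k3 as [e4 k3]; apply andP in k3 as [e5 e6].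
  pose proof (good_uniq g e1 e4); pose proof (good_uniq g' e2 e5).
  apply (app_uniq (good_inT g e1) e3), pairIn_cong with v' y' u'; eqt.
Qed.

(** The relation y = b(x) in the form that [isGraph] expects: index 0 is y and index 1 is x, the
    latter being what index 0 of [b] denotes. *)
Definition body (r : nat -> nat) (b : dtm) : sfm := den (ncons 1 (fun i => 2 + r i)) b 0.

Lemma inst2_body r b x y : inst2 (body r b) y x = den (ncons x r) b y.
Proof. unfold body; rewrite sren_den; apply den_ext_all; now intros [|i]. Qed.

(** [DLam] hides its domain behind an existential quantifier. As s has only one interpreting set,
    the hidden domain may be replaced by the given a. *)
Lemma den_lam G r s b z a : G ⊢ tyset s a ->
  (G ⊢ den r (DLam (ty_tr s) b) z <-> G ⊢ isGraph z a (body r b)).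
Proof.
intro ha.
assert (E : den r (DLam (ty_tr s) b) z =
   Ex (tyset s 0 ∧ isGraph (S z) 0 (sren (upr (upr S)) (body r b)))).
{ cbn [den]; rewrite den_ty; unfold isGraph, body; rewrite !sren_den.
  symmetry; rewrite (@den_ext_all b _ (ncons 1 (fun i => 4 + r i)));
    [reflexivity|now intros [|i]]. }
assert (F : forall a, inst2 (isGraph 1 0 (sren (upr (upr (fun i => 2 + i))) (body r b))) a z
   = isGraph z a (body r b)).
{ intro a'; rewrite sren_isGraph, sren_comp; cbn; f_equal.
  apply sren_id; now intros [|[|i]]. }
rewrite E; split; intro h.
- iex h a' e; apply andP in e as [e1 e2].
  rewrite sren_comp in e2; rewrite <- F; apply inst2_cong with z a'; [eqt| |].
  + exact (tyset_uniq e1 ha).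
  + rewrite F; refine (eq_ind _ (fun X => G ⊢ isGraph z a' X) e2 _ _).
    apply sren_id; now intros [|[|i]].
- use a; apply andP; split; [exact ha|].
  rewrite sren_comp; refine (eq_ind_r (fun X => G ⊢ isGraph z a X) h _).
  apply sren_id; now intros [|[|i]].
Qed.

Lemma lam_pairI G r s b z x y : G ⊢ den r (DLam (ty_tr s) b) z -> G ⊢ inT s x ->
  G ⊢ den (ncons x r) b y -> G ⊢ pairIn x y z.
Proof.
intros h k e; iex (tyset_ex s _) a ha; apply (den_lam _ _ _ ha) in h.
apply (graph_pairI h (inT_E ha k)); now rewrite inst2_body.
Qed.

Lemma lam_pairE G r s b z x y : G ⊢ den r (DLam (ty_tr s) b) z -> G ⊢ pairIn x y z ->
  G ⊢ den (ncons x r) b y.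
Proof.
intros h k; iex (tyset_ex s _) a ha; apply (den_lam _ _ _ ha) in h.
apply (graph_pairE h) in k as [_ k]; now rewrite inst2_body in k.
Qed.

Lemma good_lam G r s t b :
  (forall G', incl G G' -> forall x, G' ⊢ inT s x -> good G' (ncons x r) b t) ->
  good G r (DLam (ty_tr s) b) (s ⇒ t).
Proof.
intro g; split.
- apply (exE (tyset_ex s G)); intros G1 i1 a ha; ssin ha.
  apply (exE (tyset_ex t G1)); intros G2 i2 c hc; ssin hc.
  apply (CZF_weaken i2) in ha.
  assert (U : forall G', incl G2 G' -> forall x y y', G' ⊢ x ∈ a ->
    G' ⊢ inst2 (body r b) y x -> G' ⊢ inst2 (body r b) y' x -> G' ⊢ y ≐ y').
  { intros G' i x y y' hx; rewrite !inst2_body; apply (CZF_weaken i) in ha.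
    apply good_uniq with t; apply g; [incls|exact (inT_I ha hx)]. }
  assert (T : G2 ⊢ BAll a (BEx (S c) (body r b))).
  { apply BAllI; intros G3 i3 x hx; ssg; apply (CZF_weaken i3) in ha, hc.
    assert (g' : good G3 (ncons x r) b t) by (apply g; [incls|exact (inT_I ha hx)]).
    igood g' y hy e; apply BExI with y; [exact (inT_E hc hy)|].
    rewrite sinst_upr, inst2_body; exact e. }
  assert (E : G2 ⊢ Ex (isGraph 0 (S a) (sren (upr (upr S)) (body r b)))).
  { apply graph_ex; [|exact U]; iball x hx; ibspec T x as k; ibex k y hy k1; use y; exact k1. }
  apply (exE E); intros G3 i3 f hf; ssin hf; rewrite sren_comp in hf.
  apply (CZF_weaken i3) in ha, hc, T.
  rewrite sren_id in hf by now intros [|[|i]].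
  use f; apply andP; split.
  + apply (inT_fun ha hc), (graph_function hf T); intros G' i; apply U; incls.
  + apply (den_lam _ _ _ ha), hf.
- intros G' _ y y' h h'; iex (tyset_ex s _) a ha.
  apply (den_lam _ _ _ ha) in h, h'; iext p m.
  + ispec h p as k; ispec h' p as k'; exact (iff2 k' (iff1 k m)).
  + ispec h p as k; ispec h' p as k'; exact (iff2 k (iff1 k' m)).
Qed.

Lemma den_rec G r s b f z w a b' f' : G ⊢ isOmega w -> G ⊢ tyset s a ->
  G ⊢ den r b b' -> G ⊢ den r f f' -> G ⊢ isRec z w a b' f' ->
  G ⊢ den r (DRec (ty_tr s) b f) z.
Proof.
intros; cbn [den]; rewrite den_ty; use w; use a; use b'; use f'.
repeat (apply andP; split; [assumption|]); assumption.
Qed.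

Lemma den_rec_inv G r s b f z w a b' f' : G ⊢ isOmega w -> G ⊢ tyset s a ->
  good G r b s -> good G r f (s ⇒ N ⇒ s) ->
  G ⊢ den r b b' -> G ⊢ den r f f' -> G ⊢ den r (DRec (ty_tr s) b f) z ->
  G ⊢ isRec z w a b' f'.
Proof.
intros hw ha gb gf hb hf h; cbn [den] in h; rewrite den_ty in h.
(* The last three conjuncts of the unfolded [DRec] are [isRec] by conversion. *)
change (G ⊢ Ex (Ex (Ex (Ex (isOmega 3 ∧ tyset s 2 ∧ den (fun i => 4 + r i) b 1 ∧
  den (fun i => 4 + r i) f 0 ∧ isRec (4 + z) 3 2 1 0))))) in h.
iex h w1 k; iex k a1 k1; iex k1 b1 k2; iex k2 f1 k3.
apply andP in k3 as [e1 k3]; apply andP in k3 as [e2 k3];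
  apply andP in k3 as [e3 k3]; apply andP in k3 as [e4 e5].
pose proof (omega_uniq e1 hw); pose proof (tyset_uniq e2 ha);
  pose proof (good_uniq gb e3 hb); pose proof (good_uniq gf e4 hf).
apply (@sren_cong (isRec 0 1 2 3 4) G
  (ncons z (ncons w1 (ncons a1 (ncons b1 (ncons f1 ids)))))
  (ncons z (ncons w (ncons a (ncons b' (ncons f' ids)))))); [|exact e5].
intros [|[|[|[|[|?]]]]]; cbn; assumption || apply cz_refl.
Qed.

(** F interprets N ⇒ s, so a member of (s ⇒ N ⇒ s)* is a function from a to F. *)
Lemma rec_setting G s w a b f F : G ⊢ isOmega w -> G ⊢ tyset s a ->
  G ⊢ isFunSet F w a -> G ⊢ inT s b -> G ⊢ inT (s ⇒ N ⇒ s) f ->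
  (G ⊢ isOmega w) /\ (G ⊢ b ∈ a) /\ (G ⊢ isFunction f a F) /\ (G ⊢ isFunSet F w a).
Proof.
intros hw ha hF hb hf; repeat split; auto; [exact (inT_E ha hb)|].
apply (inT_fun_inv ha (t := N ⇒ s)); [|exact hf].
rewrite tyset_arr; use w; use a; repeat (apply andP; split); assumption.
Qed.

Lemma good_rec G r s b f : good G r b s -> good G r f (s ⇒ N ⇒ s) ->
  good G r (DRec (ty_tr s) b f) (N ⇒ s).
Proof.
intros gb gf; split.
- iex (omega_ex _) w hw; iex (tyset_ex s _) a ha; igood gb b' tb hb; igood gf f' tf hf.
  iex (funset_ex _ w a) F hF; iex (rec_ex (rec_setting hw ha hF tb tf)) z hz.
  use z; apply andP; split.
  + exact (inT_fun (s := N) hw ha (cz_andE1 hz)).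
  + exact (den_rec hw ha hb hf hz).
- intros G' i y y' h h'; apply (good_weaken i) in gb, gf; clear i.
  iex (omega_ex _) w hw; iex (tyset_ex s _) a ha; igood gb b' tb hb; igood gf f' tf hf.
  iex (funset_ex _ w a) F hF; apply (rec_uniq (rec_setting hw ha hF tb tf));
    eapply den_rec_inv; eassumption.
Qed.

(** * Terms and substitution *)

(** Inversion of a variable in a non-empty context. The return type computes by cases on the
    context, which avoids equations between dependent indices. *)
Lemma var_case C s (P : forall t, var (s :: C) t -> Prop) :
  P s VZ -> (forall t (v : var C t), P t (VS v)) -> forall t v, P t v.
Proof.
intros h0 hS t v; revert P h0 hS.
refine (match v in var C' t' return
  match C' return var C' t' -> Prop with
  | [] => fun _ => True
  | s :: C => fun v => forall P : forall t, var (s :: C) t -> Prop,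
      P s VZ -> (forall t (v : var C t), P t (VS v)) -> P t' v
  end v with VZ => _ | VS v => _ end); auto.
Qed.

Definition env (G : list sfm) (r : nat -> nat) (C : list ty) : Prop :=
  forall s (v : var C s), G ⊢ inT s (r (idx v)).

(** What it means for [e] to lead from [r] to [r']: each variable has under [r'] the value that the
    term replacing it has under [r]. *)
Definition subrel G r r' C D (e : sub C D) : Prop :=
  forall s (v : var C s), G ⊢ den r (tm_tr (e s v)) (r' (idx v)).

Lemma env_weaken G G' r C : incl G G' -> env G r C -> env G' r C.
Proof. intros i h s v; exact (CZF_weaken i (h s v)). Qed.

Lemma subrel_weaken G G' r r' C D (e : sub C D) :
  incl G G' -> subrel G r r' e -> subrel G' r r' e.
Proof. intros i h s v; exact (CZF_weaken i (h s v)). Qed.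

Ltac weaken_hook i ::=
  match goal with
  | h : good _ _ _ _ |- _ => apply (good_weaken i) in h
  | h : env _ _ _ |- _ => apply (env_weaken i) in h
  | h : subrel _ _ _ _ |- _ => apply (subrel_weaken i) in h
  end.

Lemma env_cons G r C s x : env G r C -> G ⊢ inT s x -> env G (ncons x r) (s :: C).
Proof. intros h k t v; revert t v; apply var_case; [exact k|exact h]. Qed.

Lemma fvs_cst P s (c : cst s) : fvs P (cst_tr c).
Proof. destruct c; cbn; repeat split; apply fvs_ty. Qed.

Lemma good_cst s (c : cst s) : forall G r, good G r (cst_tr c) s.
Proof.
destruct c; intros G q; cbn [cst_tr].
- apply good_empty.
- apply (@good_lam _ _ N N); intros G1 i1 x hx; now apply good_succ, good_var.
- apply good_lam; intros G1 i1 x hx; apply good_lam; intros G2 i2 y hy.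
  apply (CZF_weaken i2) in hx; now apply good_rec; apply good_var.
- apply good_lam; intros G1 i1 x hx; apply good_lam; intros G2 i2 y hy.
  apply (CZF_weaken i2) in hx; now apply good_pair; apply good_var.
- apply good_lam; intros G1 i1 x hx; now apply good_fst with t, good_var.
- apply good_lam; intros G1 i1 x hx; now apply good_snd with s, good_var.
- apply good_lam; intros G1 i1 x hx; apply good_lam; intros G2 i2 y hy.
  apply (CZF_weaken i2) in hx; now apply good_var.
- apply good_lam; intros G1 i1 x hx; apply good_lam; intros G2 i2 y hy.
  apply good_lam; intros G3 i3 z hz.
  apply (CZF_weaken i2), (CZF_weaken i3) in hx; apply (CZF_weaken i3) in hy.
  apply good_app with s; [apply good_app with r|apply good_app with r];
    now apply good_var.
Qed.

Lemma good_tm C s (a : tm C s) : forall G r, env G r C -> good G r (tm_tr a) s.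
Proof.
induction a; intros G r h; cbn [tm_tr].
- apply good_var, h.
- apply good_cst.
- apply good_app with s; auto.
Qed.

Lemma den_tren C s (a : tm C s) : forall D (f : forall s, var C s -> var D s) r r' z,
  (forall s v, r (idx (f s v)) = r' (idx v)) ->
  den r (tm_tr (tren f a)) z = den r' (tm_tr a) z.
Proof.
induction a; intros D f r r' z h; cbn.
- now rewrite h.
- apply den_ext with (fun _ => False); [apply fvs_cst|tauto].
- erewrite IHa1, IHa2; [reflexivity|..]; cbn; auto.
Qed.

(** The content is in the case of a variable: [e s v] has the value that [r'] gives to v, and no
    other by uniqueness of denotation. *)
Lemma tm_subst C s (a : tm C s) : forall D (e : sub C D) G r r' z,
  env G r D -> env G r' C -> subrel G r r' e ->
  G ⊢ den r (tm_tr (tsub e a)) z <-> G ⊢ den r' (tm_tr a) z.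
Proof.
induction a; intros D e G r r' z h h' k; cbn [tsub tm_tr].
- split; intro d.
  + exact (good_uniq (good_tm (e s v) h) d (k s v)).
  + apply den_eq with (r' (idx v)); [apply eq_sym, d|apply k].
- rewrite (@den_ext (cst_tr c) (fun _ => False) r r'); [tauto|apply fvs_cst|tauto].
- split; intro d; cbn [den] in d; iex d u d1; iex d1 v d2;
    apply andP in d2 as [d2 d3]; apply andP in d3 as [d3 d4].
  + apply den_app with u v; [now apply (IHa1 D e G r)|now apply (IHa2 D e G r)|exact d4].
  + apply den_app with u v; [now apply (IHa1 D e G r r')|now apply (IHa2 D e G r r')|exact d4].
Qed.

Lemma subrel_up G r C D (e : sub C D) r' s x : subrel G r r' e ->
  subrel G (ncons x r) (ncons x r') (up (t := s) e).
Proof.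
intros h t v; revert t v; apply var_case.
- apply cz_refl.
- intros t v; cbn; erewrite den_tren; [apply h|reflexivity].
Qed.

(** * Translated formulas *)

Lemma fm_allI G r C s (A : fm (s :: C)) :
  (forall G', incl G G' -> forall x, G' ⊢ inT s x -> G' ⊢ sren (ncons x r) (fm_tr A)) ->
  G ⊢ sren r (fm_tr (FAll A)).
Proof.
intro h; apply allI; intro x.
change (G ⊢ (sinst (sren (upr r) (inT s 0)) x ⊃ sinst (sren (upr r) (fm_tr A)) x)).
rewrite !sinst_upr, sren_inT; apply impI; intros G' i; exact (h G' i x).
Qed.

Lemma fm_allE G r C s (A : fm (s :: C)) x :
  G ⊢ sren r (fm_tr (FAll A)) -> G ⊢ inT s x -> G ⊢ sren (ncons x r) (fm_tr A).
Proof.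
intros h; apply mp; apply (cz_allE x) in h.
change (G ⊢ (sinst (sren (upr r) (inT s 0)) x ⊃ sinst (sren (upr r) (fm_tr A)) x)) in h.
now rewrite !sinst_upr, sren_inT in h.
Qed.

Lemma fm_exI G r C s (A : fm (s :: C)) x :
  G ⊢ inT s x -> G ⊢ sren (ncons x r) (fm_tr A) -> G ⊢ sren r (fm_tr (FEx A)).
Proof.
intros k h; apply cz_exI with x.
change (G ⊢ (sinst (sren (upr r) (inT s 0)) x ∧ sinst (sren (upr r) (fm_tr A)) x)).
rewrite !sinst_upr, sren_inT; now apply andP.
Qed.

Lemma fm_exE G r C s (A : fm (s :: C)) B : G ⊢ sren r (fm_tr (FEx A)) ->
  (forall G', incl G G' -> forall x, G' ⊢ inT s x -> G' ⊢ sren (ncons x r) (fm_tr A) ->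
    G' ⊢ B) -> G ⊢ B.
Proof.
intros h k; apply (exE h); intros G' i x e.
change (G' ⊢ (sinst (sren (upr r) (inT s 0)) x ∧ sinst (sren (upr r) (fm_tr A)) x)) in e.
rewrite !sinst_upr, sren_inT in e; apply andP in e as [e1 e2].
exact (k G' i x e1 e2).
Qed.

Lemma eq_dtmI G r t u z : G ⊢ den r t z -> G ⊢ den r u z -> G ⊢ sren r (eq_dtm t u).
Proof.
intros h k; use z; use z.
repeat (apply andP; split); [exact h|exact k|apply cz_refl].
Qed.

Lemma eq_dtmE G r t u : G ⊢ sren r (eq_dtm t u) ->
  G ⊢ Ex (den (fun i => S (r i)) t 0 ∧ den (fun i => S (r i)) u 0).
Proof.
intro h; cbn in h; rewrite !sren_den in h; cbn in h.
iex h x k; iex k y e; apply andP in e as [e1 e]; apply andP in e as [e2 e3].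
use x; apply andP; split; [exact e1|exact (den_eq (eq_sym e3) e2)].
Qed.

(** Under a quantifier both valuations are extended by the same x. Relativization supplies x in s*,
    which preserves [env]. Weakening, instantiation and the substitutions in induction, ∃! and iRC!
    are all instances. *)
Lemma fm_subst C (A : fm C) : forall D (e : sub C D) G r r',
  env G r D -> env G r' C -> subrel G r r' e ->
  G ⊢ sren r (fm_tr (fsub e A)) <-> G ⊢ sren r' (fm_tr A).
Proof.
induction A; intros D e G' r r' h h' k.
- tauto.
- split; intro d; apply eq_dtmE in d; iex d z d1; apply andP in d1 as [d1 d2];
    apply eq_dtmI with z; revert d1 d2; cbn [fsub]; rewrite !tm_subst; eauto.
- specialize (IHA1 D e G' r r' h h' k); specialize (IHA2 D e G' r r' h h' k).
  cbn in *; rewrite !andP; tauto.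
- split; intro d; cbn in *; ior d d1;
    (apply cz_orI1; now apply (IHA1 D e _ r r')) ||
    (apply cz_orI2; now apply (IHA2 D e _ r r')).
- split; intro d; cbn in *; iimp d1; apply (IHA2 D e _ r r'); auto; apply (mp d);
    now apply (IHA1 D e _ r r').
- split; intro d; apply fm_allI; intros G1 i; weaken_hyps i; intros x hx;
    pose proof (env_cons h hx) as k1; pose proof (env_cons h' hx) as k2;
    pose proof (subrel_up (s := s) x k) as k3;
    apply (IHA _ (up e) _ _ _ k1 k2 k3); exact (fm_allE d hx).
- split; intro d; apply (fm_exE d); intros G1 i; weaken_hyps i; intros x hx d1;
    pose proof (env_cons h hx) as k1; pose proof (env_cons h' hx) as k2;
    pose proof (subrel_up (s := s) x k) as k3;
    apply fm_exI with x; auto; apply (IHA _ (up e) _ _ _ k1 k2 k3); exact d1.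
Qed.

Lemma fm_wk G r C s (A : fm C) x : env G r C -> G ⊢ inT s x ->
  G ⊢ sren (ncons x r) (fm_tr (fwk s A)) <-> G ⊢ sren r (fm_tr A).
Proof.
intros h k; apply fm_subst; auto using env_cons.
intros t v; apply cz_refl.
Qed.

Lemma fm_inst G r C s (A : fm (s :: C)) a x : env G r C ->
  G ⊢ den r (tm_tr a) x ->
  G ⊢ sren r (fm_tr (finst A a)) <-> G ⊢ sren (ncons x r) (fm_tr A).
Proof.
intros h k; apply fm_subst; auto.
- apply env_cons; [exact h|exact (good_inT (good_tm a h) k)].
- intros t v; revert t v; apply var_case; [exact k|intros; apply cz_refl].
Qed.

(** * The axioms and rules *)

Tactic Notation "ival" constr(a) ident(h) ident(x) ident(hx) ident(e) :=
  igood (good_tm a h) x hx e.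

Lemma den_tsucc G r C (a : tm C N) n m : G ⊢ inT N n ->
  G ⊢ den r (tm_tr a) n -> G ⊢ isSucc m n -> G ⊢ den r (tm_tr (tsucc a)) m.
Proof.
intros hn h k; cbn [tsucc tm_tr].
igood (good_cst Succ G r) f hf e; apply den_app with f n; [exact e|exact h|].
refine (lam_pairI (s := N) e hn _).
use n; apply andP; split; [apply cz_refl|exact k].
Qed.

Lemma den_tsucc_inv G r C (a : tm C N) n m : G ⊢ inT N n -> env G r C ->
  G ⊢ den r (tm_tr a) n -> G ⊢ den r (tm_tr (tsucc a)) m -> G ⊢ isSucc m n.
Proof.
intros hn E h k; iex (succ_ex _ n) m' hm.
pose proof (good_uniq (good_tm (tsucc a) E) k (den_tsucc hn h hm)).
apply isSucc_cong with m' n; eqt.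
Qed.

(** The function z is described twice: as the value of F under [r], and as an abstraction under
    [r']. The latter valuation contains the arguments already consumed, so curried constants can be
    unwound one argument at a time. *)
Lemma app_lam G r r' s b F t x z : G ⊢ den r F z -> G ⊢ den r' (DLam (ty_tr s) b) z ->
  G ⊢ inT s x -> G ⊢ den r t x ->
  forall y, G ⊢ den (ncons x r') b y -> G ⊢ den r (DApp F t) y.
Proof.
intros h h' hx k y e; apply den_app with z x; [exact h|exact k|].
exact (lam_pairI h' hx e).
Qed.

Lemma lam_body G r s s1 s2 b f x : G ⊢ inT (s ⇒ s1 ⇒ s2) f ->
  G ⊢ den r (DLam (ty_tr s) b) f -> G ⊢ inT s x ->
  G ⊢ Ex (inT (s1 ⇒ s2) 0 ∧ den (fun i => S (ncons x r i)) b 0).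
Proof.
intros hf h hx; iex (app_total hf hx) g k; apply andP in k as [k1 k2].
use g; apply andP; split; [exact k1|exact (lam_pairE h k2)].
Qed.

Lemma app_lam2 G r s t u b c1 c2 x y z :
  good G r (DLam (ty_tr s) (DLam (ty_tr t) b)) (s ⇒ t ⇒ u) ->
  G ⊢ inT s x -> G ⊢ inT t y -> G ⊢ den r c1 x -> G ⊢ den r c2 y ->
  G ⊢ den (ncons y (ncons x r)) b z ->
  G ⊢ den r (DApp (DApp (DLam (ty_tr s) (DLam (ty_tr t) b)) c1) c2) z.
Proof.
intros g hx hy e1 e2 e; igood g f hf d; iex (lam_body hf d hx) h k.
apply andP in k as [k1 k2]; cbn [ncons] in k2.
refine (app_lam _ k2 hy e2 e); exact (app_lam d d hx e1 k2).
Qed.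

Lemma app_lam3 G r s t u u' b c1 c2 c3 x y z v :
  good G r (DLam (ty_tr s) (DLam (ty_tr t) (DLam (ty_tr u) b))) (s ⇒ t ⇒ u ⇒ u') ->
  G ⊢ inT s x -> G ⊢ inT t y -> G ⊢ inT u z ->
  G ⊢ den r c1 x -> G ⊢ den r c2 y -> G ⊢ den r c3 z ->
  G ⊢ den (ncons z (ncons y (ncons x r))) b v ->
  G ⊢ den r (DApp (DApp (DApp (DLam (ty_tr s) (DLam (ty_tr t) (DLam (ty_tr u) b)))
         c1) c2) c3) v.
Proof.
intros g hx hy hz e1 e2 e3 e; igood g f hf d; iex (lam_body hf d hx) h k.
apply andP in k as [k1 k2]; iex (lam_body k1 k2 hy) h' k'.
apply andP in k' as [k1' k2'].
refine (app_lam _ k2' hz e3 e).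
refine (app_lam _ k2 hy e2 k2'); exact (app_lam d d hx e1 k2).
Qed.

Lemma den_pair G r t u x y p : G ⊢ den r t x -> G ⊢ den r u y -> G ⊢ isPair p x y ->
  G ⊢ den r (DPair t u) p.
Proof. intros h k e; use x; use y; repeat (apply andP; split); assumption. Qed.

Lemma pair_value G r C s t (a : tm C s) (b : tm C t) x y p : env G r C ->
  G ⊢ den r (tm_tr a) x -> G ⊢ den r (tm_tr b) y -> G ⊢ isPair p x y ->
  G ⊢ den r (tm_tr (TApp (TApp (TCst (Pair s t)) a) b)) p.
Proof.
intros E h k e; refine (app_lam2 (good_cst (Pair s t) G r) _ _ h k _).
- exact (good_inT (good_tm a E) h).
- exact (good_inT (good_tm b E) k).
- apply den_pair with x y; [apply cz_refl|apply cz_refl|exact e].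
Qed.

Lemma fst_value G r C s t (a : tm C (s ⊗ t)) x y p : env G r C ->
  G ⊢ den r (tm_tr a) p -> G ⊢ isPair p x y ->
  G ⊢ den r (tm_tr (TApp (TCst (Fst s t)) a)) x.
Proof.
intros E h k; igood (good_cst (Fst s t) G r) f hf e.
refine (app_lam e e (good_inT (good_tm a E) h) h _).
use p; use y; apply andP; split; [apply cz_refl|exact k].
Qed.

Lemma snd_value G r C s t (a : tm C (s ⊗ t)) x y p : env G r C ->
  G ⊢ den r (tm_tr a) p -> G ⊢ isPair p x y ->
  G ⊢ den r (tm_tr (TApp (TCst (Snd s t)) a)) y.
Proof.
intros E h k; igood (good_cst (Snd s t) G r) f hf e.
refine (app_lam e e (good_inT (good_tm a E) h) h _).
use p; use x; apply andP; split; [apply cz_refl|exact k].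
Qed.

Lemma rec_value G r C s (a : tm C s) (f : tm C (s ⇒ N ⇒ s)) x g w A h : env G r C ->
  G ⊢ den r (tm_tr a) x -> G ⊢ den r (tm_tr f) g -> G ⊢ isOmega w -> G ⊢ tyset s A ->
  G ⊢ isRec h w A x g ->
  G ⊢ den r (tm_tr (TApp (TApp (TCst (Rec s)) a) f)) h.
Proof.
intros E e1 e2 hw hA k; refine (app_lam2 (good_cst (Rec s) G r) _ _ e1 e2 _).
- exact (good_inT (good_tm a E) e1).
- exact (good_inT (good_tm f E) e2).
- refine (den_rec hw hA _ _ k); apply cz_refl.
Qed.

Lemma rec_value_ex G s w A x g : G ⊢ isOmega w -> G ⊢ tyset s A ->
  G ⊢ inT s x -> G ⊢ inT (s ⇒ N ⇒ s) g ->
  G ⊢ Ex (isRec 0 (S w) (S A) (S x) (S g)).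
Proof.
intros hw hA hx hg; iex (funset_ex _ w A) F hF.
exact (rec_ex (rec_setting hw hA hF hx hg)).
Qed.

Lemma sound_ind G r C (A : fm (N :: C)) : env G r C ->
  G ⊢ sren r (fm_tr (finst A (TCst Zero))) ->
  G ⊢ sren r (fm_tr (FAll (FImp A (fsub (scons (tsucc v0) shift) A)))) ->
  G ⊢ sren r (fm_tr (FAll A)).
Proof.
intros E h0 hS; apply fm_allI; intros G' i; weaken_hyps i; intros x hx.
(* The goal becomes an instance of one formula at x, the shape needed for [omega_ind]. *)
rewrite <- sinst_upr; iex (omega_ex _) w hw.
apply (omega_ind hw); [..|exact (inT_E (s := N) hw hx)]; intros G' i; weaken_hyps i.
- intros u hu; rewrite sinst_upr; now apply (fm_inst A (a := TCst Zero) E hu).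
- intros u v hv hu k; rewrite sinst_upr in *.
  pose proof (inT_I (s := N) hw hv) as tv; pose proof (inT_succ tv hu) as tu.
  pose proof (env_cons E tv) as Ev.
  (* When [v0] denotes v, [tsucc v0] denotes u; hence A with its variable replaced by the successor,
     read at v, is A read at u. *)
  apply (fm_subst (r := ncons v r) A (e := scons (tsucc v0) shift)); auto.
  + now apply env_cons.
  + intros t y; revert t y; apply var_case; [|intros; apply cz_refl].
    apply den_tsucc with v; [exact tv|apply cz_refl|exact hu].
  + exact (mp (fm_allE hS tv) k).
Qed.

Lemma sound_ax C (A : fm C) : HAax A -> forall G r, env G r C -> G ⊢ sren r (fm_tr A).
Proof.
intros [s a|s a b|s a b c|s t f g a b|a|a b|B|s a f|s a f n|s t a b|s t a b|s t p
  |s t a b|q s t f g a] G r E; cbn [fm_tr sren].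
- ival a E x hx e; exact (eq_dtmI e e).
- iimp h; iex (eq_dtmE h) z e; apply andP in e as [e1 e2]; exact (eq_dtmI e2 e1).
- iimp h; iimp k; iex (eq_dtmE h) z e; iex (eq_dtmE k) z' e'.
  apply andP in e as [e1 e2], e' as [e1' e2'].
  pose proof (good_uniq (good_tm b E) e1' e2).
  exact (eq_dtmI e1 (den_eq H e2')).
- iimp h; iimp k; iex (eq_dtmE h) u e; iex (eq_dtmE k) v e'.
  apply andP in e as [e1 e2], e' as [e1' e2'].
  iex (app_total (good_inT (good_tm f E) e1) (good_inT (good_tm a E) e1')) z d.
  apply cz_andE2 in d; apply eq_dtmI with z; apply den_app with u v; assumption.
(* The common value z of both sides would be empty and would contain the value n of a. *)
- iimp h; iex (eq_dtmE h) z e; apply andP in e as [e1 e2].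
  ival a E n hn en; pose proof (den_tsucc_inv hn E en e1) as k.
  exact (empty_ex_false _ e2 (succ_mem k)).
- iimp h; iex (eq_dtmE h) z e; apply andP in e as [e1 e2].
  ival a E n hn en; ival b E m hm em.
  pose proof (succ_inj (den_tsucc_inv hn E en e1) (den_tsucc_inv hm E em e2)) as k.
  exact (eq_dtmI en (den_eq (eq_sym k) em)).
- iimp h; apply andP in h as [h0 hS]; exact (sound_ind E h0 hS).
- ival a E x hx ex; ival f E g hg eg; iex (omega_ex _) w hw; iex (tyset_ex s _) T hT.
  iex (rec_value_ex hw hT hx hg) h hh; iex (empty_ex _) z hz.
  apply eq_dtmI with x; [|exact ex]; apply den_app with h z.
  + exact (rec_value E ex eg hw hT hh).
  + exact hz.
  + exact (rec_zero hh hz).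
- ival a E x hx ex; ival f E g hg eg; ival n E k hk ek.
  iex (omega_ex _) w hw; iex (tyset_ex s _) T hT.
  iex (rec_value_ex hw hT hx hg) h hh; iex (succ_ex _ k) m hm.
  pose proof (rec_value E ex eg hw hT hh) as eh.
  pose proof (inT_fun (s := N) hw hT (cz_andE1 hh)) as th.
  (* With y = h(k), g1 = g(y) and y1 = g1(k), the set y1 is the value of both sides. *)
  iex (app_total th hk) y e; apply andP in e as [hy e].
  iex (app_total hg hy) g1 e1; apply andP in e1 as [hg1 e1].
  iex (app_total hg1 hk) y1 e2; apply andP in e2 as [hy1 e2].
  apply eq_dtmI with y1.
  + apply den_app with h m; [exact eh|exact (den_tsucc hk ek hm)|].
    exact (rec_succ hh (inT_E (s := N) hw hk) hm e e1 e2).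
  + apply den_app with g1 k; [|exact ek|exact e2].
    apply den_app with g y; [exact eg| |exact e1].
    apply den_app with h k; [exact eh|exact ek|exact e].
- ival a E x hx ex; ival b E y hy ey; iex (pair_ex _ x y) p hp.
  apply eq_dtmI with x; [|exact ex].
  exact (fst_value E (pair_value E ex ey hp) hp).
- ival a E x hx ex; ival b E y hy ey; iex (pair_ex _ x y) p hp.
  apply eq_dtmI with y; [|exact ey].
  exact (snd_value E (pair_value E ex ey hp) hp).
- ival p E P hP eP; iex (inT_prodE hP) x k; iex k y k1.
  apply andP in k1 as [e1 k1]; apply andP in k1 as [e2 e3].
  apply eq_dtmI with P; [|exact eP].
  exact (pair_value E (fst_value E eP e3) (snd_value E eP e3) e3).
- ival a E x hx ex; ival b E y hy ey; apply eq_dtmI with x; [|exact ex].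
  refine (app_lam2 (good_cst (CombK s t) G r) hx hy ex ey _); apply cz_refl.
- ival f E u hu eu; ival g E v hv ev; ival a E x hx ex.
  iex (app_total hu hx) u1 k; apply andP in k as [hu1 k].
  iex (app_total hv hx) v1 k1; apply andP in k1 as [hv1 k1].
  iex (app_total hu1 hv1) z k2; apply andP in k2 as [hz k2].
  apply eq_dtmI with z.
  + refine (app_lam3 (good_cst (CombS q s t) G r) hu hv hx eu ev ex _).
    apply den_app with u1 v1; [|..|exact k2].
    * apply den_app with u x; [apply cz_refl..|exact k].
    * apply den_app with v x; [apply cz_refl..|exact k1].
  + apply den_app with u1 v1; [|..|exact k2].
    * apply den_app with u x; assumption.
    * apply den_app with v x; assumption.
Qed.

(* [iRC!] is sound because a functional formula on ω has a graph, by strong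
   collection. *)
Lemma sound_iRC G r C (A : fm (N :: N :: C)) : env G r C ->
  G ⊢ sren r (fm_tr (FAll (FExU A))) ->
  G ⊢ sren r (fm_tr (FEx (s := N ⇒ N)
        (FAll (s := N) (fsub (scons (TApp v1 v0) (scons v0 shift2)) A)))).
Proof.
intros E h; iex (omega_ex _) w hw.
(* Membership in N* is built into B because the translated ∃! gives uniqueness only among members of
   N*. *)
set (B := inT N 0 ∧ sren (ncons 0 (ncons 1 (fun i => 2 + r i))) (fm_tr A)).
assert (EB : forall y x, inst2 B y x = (inT N y ∧ sren (ncons y (ncons x r)) (fm_tr A))%sfm).
{ intros y x; unfold B; cbn [sren]; rewrite sren_inT, sren_comp; f_equal.
  apply sren_ext; now intros [|[|i]]. }
clearbody B.
assert (U : forall G', incl G G' -> forall x y y', G' ⊢ x ∈ w ->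
   G' ⊢ inst2 B y x -> G' ⊢ inst2 B y' x -> G' ⊢ y ≐ y').
{ intros G' i; weaken_hyps i; intros x y y' hx; rewrite !EB.
  intros [hy k]%andP [hy' k']%andP; apply (inT_I (s := N) hw) in hx.
  pose proof (cz_andE2 (fm_allE h hx)) as h1; apply (fm_allE (x := y)) in h1; [|exact hy].
  apply (fm_allE (x := y')) in h1; [|exact hy'].
  pose proof (env_cons E hx) as E1; pose proof (env_cons E1 hy) as E2.
  pose proof (env_cons E1 hy') as E3; pose proof (env_cons E2 hy') as E4.
  (* The matrix of ∃! lives over three new variables, valued y', y and x; its two copies of A are A
     at y and A at y'. *)
  assert (h2 : G ⊢ sren (ncons y' (ncons y (ncons x r)))
    (fm_tr (G := N :: N :: N :: C) (FEq v1 v0))).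
  { apply (mp h1); apply andP; split;
      [apply (fm_subst A E4 E2)|apply (fm_subst A E4 E3)]; try assumption;
      intros t v; revert t v; apply var_case; intros; apply cz_refl. }
  iex (eq_dtmE h2) z e.
  apply andP in e as [e1 e2]; cbn in e1, e2; eqt. }
assert (T : G ⊢ BAll w (BEx (S w) B)).
{ clear U; iball x hx; apply (inT_I (s := N) hw) in hx.
  apply (fm_exE (r := ncons x r) (A := A) (cz_andE1 (fm_allE h hx)));
    intros G' i y hy e; weaken_hyps i.
  apply BExI with y; [exact (inT_E (s := N) hw hy)|].
  rewrite sinst_upr, EB; now apply andP. }
assert (X : G ⊢ Ex (isGraph 0 (S w) (sren (upr (upr S)) B))).
{ apply graph_ex; [|exact U]; clear U; iball x hx; ibspec T x as k.
  ibex k y hy k1; use y; exact k1. }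
apply (exE X); intros G1 i1 f hf; ssin hf; rewrite sren_comp in hf.
rewrite sren_id in hf by now intros [|[|i]].
assert (U1 : forall G', incl G1 G' -> forall x y y', G' ⊢ x ∈ w ->
   G' ⊢ inst2 B y x -> G' ⊢ inst2 B y' x -> G' ⊢ y ≐ y').
{ intros G' i; apply U; incls. }
clear U X; weaken_hyps i1; pose proof (graph_function hf T U1) as hF; clear U1.
pose proof (inT_fun (s := N) (t := N) hw hw hF) as tf.
apply fm_exI with f; [exact tf|].
apply fm_allI; intros G' i x hx; weaken_hyps i.
iex (app_total tf hx) y e; apply andP in e as [hy e].
destruct (graph_pairE hf e) as [_ k]; rewrite EB in k; apply cz_andE2 in k.
(* In the scope of the conclusion [v1] is f and [v0] is x, so [TApp v1 v0] denotes the y for which A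
   was read off the graph. *)
apply (fm_subst (r' := ncons y (ncons x r)) A); [..|exact k].
- now apply env_cons; [apply env_cons|].
- now apply env_cons; [apply env_cons|].
- intros t v; revert t v; apply var_case; [|apply var_case; intros; apply cz_refl].
  apply den_app with f x; [apply cz_refl..|exact e].
Qed.

(** * Soundness of derivations *)

Definition hyps (G : list sfm) (r : nat -> nat) C (H : list (fm C)) : Prop :=
  forall B, In B H -> G ⊢ sren r (fm_tr B).

Lemma hyps_weaken G G' r C (H : list (fm C)) : incl G G' -> hyps G r H -> hyps G' r H.
Proof. intros i h B b; exact (CZF_weaken i (h B b)). Qed.

Ltac weaken_hook i ::=
  match goal with
  | h : good _ _ _ _ |- _ => apply (good_weaken i) in h
  | h : env _ _ _ |- _ => apply (env_weaken i) in h
  | h : hyps _ _ _ |- _ => apply (hyps_weaken i) in h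
  end.

Lemma hyps_cons G r C (H : list (fm C)) A :
  hyps G r H -> G ⊢ sren r (fm_tr A) -> hyps G r (A :: H).
Proof. intros h k B [<-|b]; auto. Qed.

Lemma hyps_wk G r C (H : list (fm C)) s x : env G r C -> G ⊢ inT s x ->
  hyps G r H -> hyps G (ncons x r) (map (fwk s) H).
Proof. intros E hx h B [B' [<- b]]%in_map_iff; apply fm_wk; auto. Qed.

(** List and valuation are arbitrary, so that the quantifier rules may extend both. In ∀-elimination
    and ∃-introduction the term is represented by a name for its value, which [good_tm] supplies
    together with membership in s*. *)
Lemma soundness C (H : list (fm C)) (A : fm C) : HA H A ->
  forall G r, env G r C -> hyps G r H -> G ⊢ sren r (fm_tr A).
Proof.
induction 1 as [C H A i|C H A a|C H A d IH|C H A B d1 IH1 d2 IH2|C H A B d IH|C H A B d IH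
  |C H A B d IH|C H A B d IH|C H A B D d1 IH1 d2 IH2 d3 IH3|C H A B d IH
  |C H A B d1 IH1 d2 IH2|C H s A d IH|C H s A a d IH|C H s A a d IH
  |C H s A B d1 IH1 d2 IH2|C H A d IH]; intros G r E hH.
- now apply hH.
- now apply sound_ax.
- now apply cz_botE, (IH G r).
- apply andP; split; [now apply IH1|now apply IH2].
- exact (cz_andE1 (IH G r E hH)).
- exact (cz_andE2 (IH G r E hH)).
- now apply cz_orI1, (IH G r).
- now apply cz_orI2, (IH G r).
- ior (IH1 G r E hH) k; [apply IH2|apply IH3]; auto using hyps_cons.
- iimp k; apply IH; auto using hyps_cons.
- exact (mp (IH1 G r E hH) (IH2 G r E hH)).
- apply fm_allI; intros G' i x hx; weaken_hyps i; apply IH; auto using env_cons, hyps_wk.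
- ival a E x hx e; apply (fm_inst A E e), (fm_allE (IH _ _ E hH) hx).
- ival a E x hx e; apply fm_exI with x; [exact hx|].
  apply (fm_inst A E e), (IH _ _ E hH).
- apply (fm_exE (IH1 G r E hH)); intros G' i x hx k; weaken_hyps i.
  apply (fm_wk (s := s) B E hx), IH2; auto using env_cons, hyps_wk, hyps_cons.
(* The premise has an empty list of hypotheses, for which [hyps] holds vacuously. *)
- apply sound_iRC; [exact E|]; apply IH; [exact E|intros B []].
Qed.

(** The offset k is generalized because the tail of the context starts one index further. *)
Lemma env_ctx G C : forall k, G ⊢ ctx_tr k C -> env G (fun i => k + i) C.
Proof.
induction C as [|s C IH]; intros k h.
- intros t v; inversion v.
- apply andP in h as [h1 h2]; apply IH in h2; intros t v; revert t v; apply var_case.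
  + cbn; rewrite Nat.add_0_r; exact h1.
  + intros t v; cbn; rewrite Nat.add_succ_r; apply h2.
Qed.

Theorem proposition5p9 :
  forall (G : list ty) (A : fm G),
    HAderivable A -> CZFproves (Imp (ctx_tr 0 G) (fm_tr A)).
Proof.
intros C A d; apply impI; intros G _ h.
(* The valuation is the identity: variable i of A is index i of its translation. *)
rewrite <- (@sren_id (fm_tr A) ids) by reflexivity.
apply (soundness d); [exact (env_ctx h)|intros B []].
Qed.
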